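(* Let $n,s,N\ge 1$ be integers, let $t:\{1,\dots,n\}\to\{1,\dots,s\}$ and $h:\{1,\dots,n\}\to\mathcal{M}_{N\times N}(\mathbb{C})$ be functions, and let $\sigma\in\mathcal{S}_n$ be a permutation. If $\mathbf{W}_1\in\mathcal{W}_N(\Sigma_1,p_1),\ \mathbf{W}_2\in\mathcal{W}_N(\Sigma_2,p_2),\dots,\mathbf{W}_s\in\mathcal{W}_N(\Sigma_s,p_s)$ are independent, then $$E\big(q_{\sigma,t,h}(\mathbf{W}_1,\mathbf{W}_2,\dots,\mathbf{W}_s)\big)=\sum_{\alpha\in\mathcal{S}_n(t)}p_1^{\#\mathcal{C}_1(\alpha)}p_2^{\#\mathcal{C}_2(\alpha)}\cdots p_s^{\#\mathcal{C}_s(\alpha)}\,q_{\sigma\alpha,t,h}(\Sigma_1,\Sigma_2,\dots,\Sigma_s).$$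
   Context: Complex Wishart law: let $\Sigma$ be an $N\times N$ Hermitian positive-definite matrix (i.e. $x^*\Sigma x>0$ for all non-zero $x\in\mathbb{C}^N$), and let $p\in\{1,2,\dots,N\}\cup(N,\infty)$. A random $N\times N$ Hermitian matrix $\mathbf{W}$ has the complex Wishart law with shape parameter $p$ and scale parameter $\Sigma$, written $\mathbf{W}\in\mathcal{W}_N(\Sigma,p)$, if $$E\big(\exp(\mathrm{tr}(\theta\mathbf{W}))\big)=(\det(I-\theta\Sigma))^{-p}$$ for all Hermitian matrices $\theta$ such that $\Sigma^{-1}-\theta$ is positive-definite. $\mathcal{S}_n$ is the group of permutations of $\{1,\dots,n\}$, and $\sigma\alpha$ denotes the composition $\sigma\circ\alpha$. $\mathcal{C}(\sigma)$ denotes the set of cycles of a permutation $\sigma$ (fixed points count as cycles of length one). For $\sigma\in\mathcal{S}_n$, $t:\{1,\dots,n\}\to\{1,\dots,s\}$, $h:\{1,\dots,n\}\to\mathcal{M}_{N\times N}(\mathbb{C})$ and $N\times N$ matrices $\mathbf{x}_1,\dots,\mathbf{x}_s$, $$q_{\sigma,t,h}(\mathbf{x}_1,\dots,\mathbf{x}_s)=\prod_{c\in\mathcal{C}(\sigma)}\mathrm{tr}\Big(\prod_{j\in c}h(j)\mathbf{x}_{t(j)}\Big),$$ where $\mathrm{tr}$ is the unnormalized trace and the matrix product is taken in the order in which the integers $j$ appear in the cycle $c$; i.e. for $c=(j_1,j_2,\dots,j_k)$ with $j_{i+1}=\sigma(j_i)$ the factor is $\mathrm{tr}\big(h(j_1)\mathbf{x}_{t(j_1)}h(j_2)\mathbf{x}_{t(j_2)}\cdots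 h(j_k)\mathbf{x}_{t(j_k)}\big)$. $\mathcal{S}_n(t)=\{\pi\in\mathcal{S}_n:\ t=t\circ\pi\}$ is the set of $t$-preserving (''color-preserving'') permutations. For $\alpha\in\mathcal{S}_n(t)$, every cycle of $\alpha$ lies in a single set $t^{-1}(r)$, and $\mathcal{C}_r(\alpha)$ denotes the set of those cycles of $\alpha$ contained in $t^{-1}(r)$, $r=1,\dots,s$ (with $\mathcal{C}_r(\alpha)=\emptyset$ if $t^{-1}(r)=\emptyset$). $\#$ denotes cardinality. *)

(* Defs.v *)
From HB Require Import structures.
From mathcomp Require Import all_boot all_order all_algebra all_fingroup.
From mathcomp Require Import sesquilinear spectral.
From mathcomp Require Import all_classical all_reals all_analysis.
From mathcomp Require Import complex.

Set Implicit Arguments.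
Unset Strict Implicit.
Unset Printing Implicit Defensive.

Import Order.TTheory GRing.Theory Num.Theory.

Local Open Scope classical_set_scope.
Local Open Scope sesquilinear_scope.
Local Open Scope complex_scope.
Local Open Scope ring_scope.

(** Permutations.  In MathComp [(a * b) x = b (a x)], so the composition
    [σ ∘ α] is the product [(α * σ)%g]. *)

(** The cycle [c] of [σ] listed as [j, σ j, σ (σ j), ...]; the choice of the
    first element is immaterial under a trace. *)
Definition cycle_word (n : nat) (sigma : {perm 'I_n}) (c : {set 'I_n}) :
    seq 'I_n :=
  if [pick j in c] is Some j then traject sigma j #|c| else [::].

Definition q (F : comNzRingType) (n s N : nat) (sigma : {perm 'I_n})
    (t : 'I_n -> 'I_s) (h : 'I_n -> 'M[F]_N) (x : 'I_s -> 'M[F]_N) : F :=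
  \prod_(c in porbits sigma)
    \tr (\big[mulmx/1%:M]_(j <- cycle_word sigma c) (h j *m x (t j))).

Definition color_preserving (n s : nat) (t : 'I_n -> 'I_s) :
    {set {perm 'I_n}} :=
  [set alpha : {perm 'I_n} | [forall i, t i == t (alpha i)]]%SET.

Definition color_cycles (n s : nat) (t : 'I_n -> 'I_s) (r : 'I_s)
    (alpha : {perm 'I_n}) : {set {set 'I_n}} :=
  [set c in porbits alpha | [forall j in c, t j == r]]%SET.

(** On [R[i]], [0 < z] means that [z] is real and positive. *)
Definition posdefmx (C : numClosedFieldType) (N : nat) (A : 'M[C]_N) : Prop :=
  forall x : 'cV[C]_N, x != 0 -> 0 < (x ^t* *m A *m x) 0 0.

Section Probability.
Context {d : measure_display} {T : measurableType d} {R : realType}.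
Variable P : probability T R.

Definition cintegrable (X : T -> R[i]) : Prop :=
  P.-integrable setT (fun w => (complex.Re (X w))%:E) /\
  P.-integrable setT (fun w => (complex.Im (X w))%:E).

Definition cexpectation (X : T -> R[i]) : R[i] :=
  fine ('E_P[fun w => complex.Re (X w)])
  +i* fine ('E_P[fun w => complex.Im (X w)]).

Definition random_hermitian_mx (N : nat) (W : T -> 'M[R[i]]_N) : Prop :=
  (forall w, W w \is hermsymmx) /\
  forall i j : 'I_N,
    measurable_fun setT (fun w => complex.Re (W w i j)) /\
    measurable_fun setT (fun w => complex.Im (W w i j)).

(** The sigma-algebra on [T] generated by a random matrix, the Borel
    sigma-algebra of complex matrices being generated by the real and imaginary
    parts of the entries. *)
Definition sigma_mx (N : nat) (W : T -> 'M[R[i]]_N) : set (set T) :=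
  <<s \bigcup_(ij in [set: 'I_N * 'I_N])
        (preimage_set_system setT (fun w => complex.Re (W w ij.1 ij.2))
           measurable
         `|` preimage_set_system setT (fun w => complex.Im (W w ij.1 ij.2))
           measurable) >>.

Definition independent_mx (s N : nat) (W : 'I_s -> T -> 'M[R[i]]_N) : Prop :=
  forall (J : {set 'I_s}) (A : 'I_s -> set T),
    (forall r, r \in J -> sigma_mx (W r) (A r)) ->
    P (\bigcap_(r in [set` J]) A r) = (\prod_(r in J) P (A r))%E.

Definition wishart_shape (N : nat) (p : R) : Prop :=
  (exists k : nat, (1 <= k <= N)%N /\ p = k%:R) \/ N%:R < p.

(** For Hermitian [theta], [tr (theta W)] and [det (I - theta Sigma)] are real
    (and the latter is positive when [Sigma^-1 - theta] is positive definite),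
    so [complex.Re] only changes their type from [R[i]] to [R]. *)
Definition complex_wishart (N : nat) (Sigma : 'M[R[i]]_N) (p : R)
    (W : T -> 'M[R[i]]_N) : Prop :=
  [/\ Sigma \is hermsymmx /\ posdefmx Sigma,
      wishart_shape N p,
      random_hermitian_mx W &
      forall theta : 'M[R[i]]_N, theta \is hermsymmx ->
        posdefmx (invmx Sigma - theta) ->
        ('E_P[fun w => expR (complex.Re (\tr (theta *m W w)))]
         = (complex.Re (\det (1%:M - theta *m Sigma)) `^ (- p))%:E)%E].

End Probability.

(* Main.v *)
Require Import Defs.
From HB Require Import structures.
From mathcomp Require Import all_boot all_order all_algebra all_fingroup.
From mathcomp Require Import sesquilinear spectral.
From mathcomp Require Import all_classical all_reals all_analysis.
From mathcomp Require Import measurable_realfun.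
From mathcomp Require Import complex.
From mathcomp Require Import ring lra.

Set Implicit Arguments.
Unset Strict Implicit.
Unset Printing Implicit Defensive.

Import Order.TTheory GRing.Theory Num.Theory.

Local Open Scope complex_scope.
Local Open Scope ring_scope.

(** The expectation of [q] is a combination of mixed moments
    [E (prod_j tr (theta_j W_(t j)))], since a product of traces along the cycles
    of [sigma] is a sum of products of matrix entries ([prod_cycle_traces]) and an
    entry is a trace against a matrix unit. Both the mixed moments and the
    expected answer [colored_trace_sum] are multilinear in the matrices [theta_j],
    so Hermitian ones suffice ([mixed_moments]), and both are symmetric, so it is
    even enough to know the powers of [X = sum_r tr (theta_r W_r)] for Hermitian
    [theta_r] ([hermitian_mixed_moments], by Ryser's formula).

    The random variable [X] is real, and its moments are the derivatives at [0] of
    its Laplace transform ([mgf_moments]). Diagonalizing the pair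
    [(Sigma_r, theta_r)] gives real numbers [lam (r, i)], the eigenvalues of
    [theta_r Sigma_r], and independence gives
    [E (exp (x X)) = prod_(r, i) (1 - x lam (r, i)) ^ (- p_r)]
    for small [x] ([joint_wishart_moments]).

    Let [mu_u = lam_u / (1 - x lam_u)]. A factor [(1 - x lam_u) ^ (- p)] has
    logarithmic derivative [p mu_u], and the derivative of [mu_u] is [mu_u ^ 2]. So
    the [k]-th derivative of the product is the product itself times a sum over
    the words [a] of length [k] in the index pairs [u = (r, i)], of
    [w(a) prod_j mu_(a j)], where prefixing a letter [u] to [a] multiplies the
    coefficient [w(a)] by [p_u] plus the number of occurrences of [u] in [a]
    ([is_derive_prod_powers_derivative]). The sum over the permutations that
    preserve [a], with weight [p] for each cycle, obeys the same recursion: a new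
    point either forms a cycle by itself, or is inserted in front of an older
    point, of the same color, in its cycle ([color_sum_rec]). Hence [w(a)] is that
    sum. Exchanging it with the sum over [a], a permutation of the [k] points is
    left with the sum, over the colorings and the eigenvalue indices that are
    constant along its cycles, of products of eigenvalues, and this is a sum of
    products of traces along its cycles ([sum_colored_trace_diag]). *)

(** * Products over the cycles of a permutation *)

Section OrbitProducts.
Context {F : comNzRingType}.

(** Meant for [P] constant on [c], where the representative is immaterial; orbits
    being nonempty, the default value [1] is never taken on them. *)
Definition orbit_value (T : finType) (P : T -> F) (c : {set T}) : F :=
  if [pick i in c] is Some i then P i else 1.

Definition orbit_prod (T : finType) (P : T -> F) (alpha : {perm T}) : F :=
  \prod_(c in porbits alpha) orbit_value P c.

(** Orbits are generated by single steps, so it is enough that [g] sends one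
    step of [alpha] inside an orbit of [beta]. *)
Lemma porbit_mono (T T' : finType) (alpha : {perm T}) (beta : {perm T'})
    (g : T -> T') :
  (forall i, g (alpha i) \in porbit beta (g i)) ->
  forall i j, i \in porbit alpha j -> g i \in porbit beta (g j).
Proof.
move=> gb i j /porbitP[k ->]; elim: k => [|k IH].
  by rewrite expg0 perm1 porbit_id.
rewrite expgSr permM; move: IH (gb ((alpha ^+ k)%g j)).
by rewrite -!eq_porbit_mem => /eqP -> /eqP ->.
Qed.

Lemma invariant_porbit (T : finType) (U : Type) (P : T -> U) (alpha : {perm T}) :
  (forall i, P (alpha i) = P i) ->
  forall i j, i \in porbit alpha j -> P i = P j.
Proof.
move=> Pa i j /porbitP[k ->]; elim: k => [|k IH]; first by rewrite expg0 perm1.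
by rewrite expgSr permM Pa.
Qed.

Lemma orbit_value_porbit (T : finType) (P : T -> F) (alpha : {perm T}) i :
  (forall i, P (alpha i) = P i) -> orbit_value P (porbit alpha i) = P i.
Proof.
move=> Pa; rewrite /orbit_value; case: pickP => [j /(invariant_porbit Pa)//|].
by move/(_ i); rewrite porbit_id.
Qed.

(** A map [f] that induces an injection from the orbits of [alpha] to those of
    [beta] transports the product over orbits. The orbits of [beta] missed by [f]
    are left out, so that this covers both a relabelling of the points and the
    addition of a new point. *)
Lemma orbit_prod_pullback (T T' : finType) (f : T -> T') (P : T' -> F)
    (alpha : {perm T}) (beta : {perm T'}) :
  (forall i, P (beta i) = P i) ->
  (forall i j, (f i \in porbit beta (f j)) = (i \in porbit alpha j)) ->
  \prod_(c in [set porbit beta (f i) | i in T]%SET) orbit_value P c =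
  orbit_prod (P \o f) alpha.
Proof.
move=> Pb fab.
have Pfa i j : i \in porbit alpha j -> P (f i) = P (f j).
  by rewrite -fab; apply: invariant_porbit.
pose g (c : {set T}) : {set T'} := if [pick i in c] is Some i then porbit beta (f i) else finset.set0.
have gE i : g (porbit alpha i) = porbit beta (f i).
  rewrite /g; case: pickP => [j|/(_ i)]; last by rewrite porbit_id.
  by move=> ji; apply/eqP; rewrite eq_porbit_mem fab.
have -> : [set porbit beta (f i) | i in T]%SET = (g @: porbits alpha)%SET.
  by rewrite /porbits -imset_comp; apply: eq_imset => i /=; rewrite gE.
rewrite big_imset /=; last first.
  move=> _ _ /imsetP[i _ ->] /imsetP[j _ ->]; rewrite !gE => /eqP.
  by rewrite eq_porbit_mem fab -eq_porbit_mem => /eqP.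
apply: eq_bigr => _ /imsetP[i _ ->]; rewrite gE orbit_value_porbit //.
by rewrite orbit_value_porbit //= => j; apply: Pfa; rewrite -{1}(expg1 alpha) mem_porbit.
Qed.

Lemma orbit_prod_conj (T : finType) (P : T -> F) (alpha pi : {perm T}) :
  (forall i, P (alpha i) = P i) ->
  orbit_prod (P \o pi) (alpha ^ pi^-1)%g = orbit_prod P alpha.
Proof.
move=> Pa; rewrite -(orbit_prod_pullback (f := pi) (beta := alpha)) //; last first.
  have apE i : ((alpha ^ pi^-1)%g i = pi^-1 (alpha (pi i)))%g.
    by rewrite conjgE invgK !permM.
  move=> i j; apply/idP/idP => [|]; last first.
    by apply: porbit_mono => k; rewrite apE permKV -{1}(expg1 alpha) mem_porbit.
  rewrite -{2}(permK pi i) -{2}(permK pi j).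
  apply: porbit_mono => k; rewrite -{1}(permKV pi k) -apE.
  by rewrite -{1}(expg1 (alpha ^ pi^-1)%g) mem_porbit.
apply: eq_bigl => c; apply/imsetP/imsetP => -[i _ ->]; first by exists (pi i).
by exists ((pi^-1)%g i); rewrite ?permKV.
Qed.

(** A cycle of a color preserving permutation has a single color, and collecting
    the cycles by color turns the product over cycles into powers. *)
Lemma orbit_prod_colors (n s : nat) (t : 'I_n -> 'I_s) (p : 'I_s -> F)
    (alpha : {perm 'I_n}) :
  alpha \in color_preserving t ->
  orbit_prod (p \o t) alpha = \prod_(r < s) p r ^+ #|color_cycles t r alpha|.
Proof.
rewrite inE => /forallP ta; have ta' i : t (alpha i) = t i by apply/esym/eqP/ta.
rewrite /orbit_prod.
under [RHS]eq_bigr => r _ do rewrite -prodr_const.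
rewrite [RHS](exchange_big_dep (mem (porbits alpha))) /=; last first.
  by move=> r c _; rewrite inE => /andP[].
apply: eq_bigr => _ /imsetP[i _ ->]; rewrite orbit_value_porbit; last first.
  by move=> j /=; rewrite ta'.
rewrite (big_pred1 (t i)) // => r; rewrite !inE imset_f //= .
apply/forall_inP/eqP => [/(_ i (porbit_id _ _))/eqP -> //|->].
by move=> j /(invariant_porbit ta') ->.
Qed.

End OrbitProducts.

(** * Color preserving permutations, counted by cycles *)

Section ColoredPermutations.
Context {F : comNzRingType}.

(** By [color_sum_rec] this is a product of rising factorials
    [p i * (p i + 1) * ... * (p i + m - 1)], one for each color [i], where [m] is
    the number of points of color [i]. *)
Definition color_sum (I : finType) (p : I -> F) (n : nat) (a : 'I_n -> I) : F :=
  \sum_(alpha : {perm 'I_n} | [forall i, a i == a (alpha i)])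
    orbit_prod (p \o a) alpha.

(** The new point [ord0] is inserted in front of [j] in the cycle of [j], and is
    a fixed point when [j] is [ord0] itself. *)
Definition insert_perm (k : nat) (j : 'I_k.+1) (alpha : {perm 'I_k}) :
    {perm 'I_k.+1} :=
  (lift_perm ord0 ord0 alpha * tperm ord0 j)%g.

Lemma insert_perm0 k (j : 'I_k.+1) (alpha : {perm 'I_k}) :
  insert_perm j alpha ord0 = j.
Proof. by rewrite permM lift_perm_id tpermL. Qed.

Lemma insert_perm_lift k (j : 'I_k.+1) (alpha : {perm 'I_k}) i :
  insert_perm j alpha (lift ord0 i) =
  if lift ord0 (alpha i) == j then ord0 else lift ord0 (alpha i).
Proof.
rewrite permM lift_perm_lift; case: eqP => [->|/eqP ne]; first by rewrite tpermR.
by rewrite tpermD // eq_sym.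
Qed.

(** The point [j] can be read off as the image of [ord0], and then [alpha] can be
    read off on the other points; both sides have [k.+1`!] elements. *)
Lemma insert_perm_bij k :
  bijective (fun u : 'I_k.+1 * {perm 'I_k} => insert_perm u.1 u.2).
Proof.
apply: inj_card_bij => [[j alpha] [j' alpha'] /= E|]; last first.
  by rewrite card_prod card_ord !card_Sn factS.
have jj' : j = j' by rewrite -(insert_perm0 j alpha) E insert_perm0.
congr pair => //; apply/permP => i; apply: (@lift_inj _ ord0).
move: E; rewrite -jj' => /mulIg E.
by rewrite -!(lift_perm_lift ord0 ord0) E.
Qed.

(** Inserting a point in a cycle neither merges nor splits the cycles of the old
    points. *)
Lemma porbit_insert_perm k (j : 'I_k.+1) (alpha : {perm 'I_k}) i l :
  (lift ord0 i \in porbit (insert_perm j alpha) (lift ord0 l)) =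
  (i \in porbit alpha l).
Proof.
set beta := insert_perm j alpha; apply/idP/idP => [il|]; last first.
  apply: porbit_mono => {i l} i.
  case: (lift ord0 (alpha i) =P j) => [e|/eqP/negPf ne].
    have <- : (beta ^+ 2)%g (lift ord0 i) = lift ord0 (alpha i).
      by rewrite expgS expg1 permM insert_perm_lift e eqxx insert_perm0.
    exact: mem_porbit.
  by have := mem_porbit beta 1 (lift ord0 i); rewrite expg1 insert_perm_lift ne.
(* [rho] merges the new point with its predecessor, so that a step of [beta]
   becomes a step of [alpha] or no step at all. *)
pose rho x := if unlift ord0 x is Some y then y
  else if unlift ord0 j is Some j' then (alpha^-1)%g j' else i.
rewrite -(_ : rho (lift ord0 i) = i) ?/rho ?liftK //.
rewrite -[X in porbit _ X](_ : rho (lift ord0 l) = l) ?/rho ?liftK // -/(rho _).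
have := @porbit_mono _ _ beta alpha rho _ _ _ il; rewrite /rho !liftK; apply.
move=> x; case: (unliftP ord0 x) => [y ->|->]; rewrite ?insert_perm0.
  rewrite insert_perm_lift; case: eqP => [<-|_]; rewrite ?unlift_none !liftK.
    by rewrite permK porbit_id.
  by rewrite -{1}(expg1 alpha) mem_porbit.
case: (unliftP ord0 j) => [j' _|_].
  by rewrite -{1}(permKV alpha j') -{1}(expg1 alpha) mem_porbit.
by rewrite porbit_id.
Qed.

(** A fixed new point is a cycle of its own; any other new point joins an existing
    cycle and leaves the value of that cycle unchanged. *)
Lemma orbit_prod_insert_perm k (P : 'I_k.+1 -> F) (j : 'I_k.+1)
    (alpha : {perm 'I_k}) :
  (forall i, P (insert_perm j alpha i) = P i) ->
  orbit_prod P (insert_perm j alpha) =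
  (if j == ord0 then P ord0 else 1) * orbit_prod (P \o lift ord0) alpha.
Proof.
set beta := insert_perm j alpha => Pb.
rewrite -(@orbit_prod_pullback _ _ _ (lift ord0) P alpha beta) //; last exact: porbit_insert_perm.
have porbitsE : porbits beta =
    (porbit beta ord0 |: [set porbit beta (lift ord0 i) | i in 'I_k])%SET.
  apply/setP => c; rewrite !inE; apply/imsetP/orP => [[i _ ->]|].
    case: (unliftP ord0 i) => [i' ->|->]; [right|by left].
    by apply/imsetP; exists i'.
  by case=> [/eqP ->|/imsetP[i _ ->]]; [exists ord0|exists (lift ord0 i)].
rewrite /orbit_prod porbitsE; case: eqP => [j0|/eqP j0].
  rewrite big_setU1 /= ?orbit_value_porbit //.
  apply/imsetP => -[i _] /eqP; rewrite eq_porbit_mem porbit_sym.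
  move=> /(@invariant_porbit _ _ (fun x => x == ord0)) /=.
  rewrite !eqxx eq_sym (negPf (neq_lift _ _)) => /(_ _)/esym H.
  suff : true = false by []; apply: H => x.
  (* An invariant set: the new point alone. *)
  have b0 : beta ord0 = ord0 by rewrite insert_perm0.
  by rewrite -{1}b0 (inj_eq perm_inj).
rewrite mul1r; apply: eq_bigl => c; rewrite !inE; apply: orb_idl => /eqP ->.
case: (unliftP ord0 j) => [j' ej|]; last by move=> e; rewrite e eqxx in j0.
apply/imsetP; exists j' => //; apply/esym/eqP; rewrite -ej eq_porbit_mem.
by have := mem_porbit beta 1 ord0; rewrite expg1 insert_perm0.
Qed.

(** The new point is either fixed, which creates a cycle of weight [p (a ord0)],
    or stands in front of one of the points of its own color, which creates no
    cycle; what remains is an arbitrary color preserving permutation of the other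
    points. *)
Lemma color_sum_rec (I : finType) (p : I -> F) (k : nat) (a : 'I_k.+1 -> I) :
  color_sum p a =
  (p (a ord0) + \sum_(l < k) (a (lift ord0 l) == a ord0)%:R)
  * color_sum p (a \o lift ord0).
Proof.
rewrite /color_sum (reindex _ (onW_bij _ (@insert_perm_bij k))) /=.
have presE j (alpha : {perm 'I_k}) :
    [forall i, a i == a (insert_perm j alpha i)] =
    (a j == a ord0) && [forall i, (a \o lift ord0) i == (a \o lift ord0) (alpha i)].
  apply/forallP/andP => [H|[/eqP aj /forallP H] x].
    have aj : a j = a ord0 by have /eqP := H ord0; rewrite insert_perm0.
    split; first exact/eqP.
    apply/forallP => i /=; have /eqP -> := H (lift ord0 i).
    by rewrite insert_perm_lift; case: (_ =P j) => [->|//]; rewrite aj.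
  case: (unliftP ord0 x) => [i ->|->]; last by rewrite insert_perm0 aj.
  have /eqP /= -> := H i; rewrite insert_perm_lift.
  by case: (_ =P j) => [->|//]; rewrite aj.
transitivity (\sum_(j < k.+1) \sum_(alpha : {perm 'I_k} | (a j == a ord0) &&
    [forall i, (a \o lift ord0) i == (a \o lift ord0) (alpha i)])
   (if j == ord0 then p (a ord0) else 1) * orbit_prod (p \o (a \o lift ord0)) alpha).
  rewrite [RHS]pair_big_dep /=; apply: eq_big => [[j alpha]|[j alpha] /= H]; first exact: presE.
  by rewrite orbit_prod_insert_perm // => i /=; have /forallP/(_ i)/eqP <- := H.
rewrite big_ord_recl mulrDl; congr (_ + _).
  by rewrite eqxx big_distrr /=.
rewrite big_distrl /=; apply: eq_bigr => l _.
case: eqP => _ /=; last by rewrite big_pred0 // mul0r.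
by rewrite mul1r; apply: eq_bigr => alpha _; rewrite mul1r.
Qed.

End ColoredPermutations.

(** * Traces along cycles as sums over indices *)

Section CycleTraces.
Context {F : comNzRingType} {I V : finType}.

Definition update (b : {ffun I -> V}) (j : I) (v : V) : {ffun I -> V} :=
  [ffun i => if i == j then v else b i].

(** A sum over functions, organised one coordinate at a time: each inner
    summation will be the summation over one intermediate index of a product of
    matrices. *)
Fixpoint sum_coords (s : seq I) (g : {ffun I -> V} -> F) (b : {ffun I -> V}) : F :=
  if s is j :: s' then \sum_(v : V) sum_coords s' g (update b j v) else g b.

Lemma eq_sum_coords s g g' : g =1 g' -> sum_coords s g =1 sum_coords s g'.
Proof.
by move=> gg'; elim: s => [|j s IH] b //=; apply: eq_bigr => v _; apply: IH.
Qed.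

Lemma sum_coords_cat s1 s2 g b :
  sum_coords (s1 ++ s2) g b = sum_coords s1 (sum_coords s2 g) b.
Proof. by elim: s1 b => [|j s IH] b //=; apply: eq_bigr => v _; apply: IH. Qed.

Lemma sum_coords_mull s (h g : {ffun I -> V} -> F) b :
  (forall b j v, j \in s -> h (update b j v) = h b) ->
  sum_coords s (fun b => h b * g b) b = h b * sum_coords s g b.
Proof.
elim: s b => [|j s IH] b //= hs; rewrite big_distrr /=; apply: eq_bigr => v _.
rewrite IH ?hs ?mem_head // => b' j' v' j's.
by rewrite hs // inE j's orbT.
Qed.

Lemma sum_coordsE s g b : uniq s ->
  sum_coords s g b =
  \sum_(b' : {ffun I -> V} | [forall i, (i \in s) || (b' i == b i)]) g b'.
Proof.
elim: s b => [|j s IH] b /=.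
  move=> _; rewrite (big_pred1 b) // => b'; apply/forallP/eqP => [H|-> i].
    by apply/ffunP => i; have /eqP := H i.
  exact/eqP.
case/andP=> js us; rewrite [RHS](partition_big (fun b' : {ffun I -> V} => b' j) predT) //=.
apply: eq_bigr => v _; rewrite IH //; apply: eq_bigl => b'.
apply/forallP/andP => [H|[/forallP H /eqP bj] i].
  split.
    apply/forallP => i; have := H i; rewrite inE ffunE.
    by case: (i =P j).
  by have := H j; rewrite (negPf js) ffunE eqxx.
have := H i; rewrite inE ffunE; case: (i =P j) => [-> _|//].
by rewrite bj eqxx orbT.
Qed.

Lemma sum_coords_full s g b : uniq s -> s =i predT ->
  sum_coords s g b = \sum_(b' : {ffun I -> V}) g b'.
Proof.
move=> us sT; rewrite sum_coordsE //; apply: eq_bigl => b'.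
by apply/forallP => i; rewrite sT.
Qed.

End CycleTraces.

Section CycleTraceFormula.
Context {F : comNzRingType} {n N : nat}.
Variables (alpha : {perm 'I_n}) (M : 'I_n -> 'M[F]_N).
Let entry (b : {ffun 'I_n -> 'I_N}) (j : 'I_n) : F := M j (b j) (b (alpha j)).

(** Summing over the indices strictly inside a path multiplies the matrices met
    along it; the hypotheses say that the two extreme indices are not among the
    summed ones. *)
Lemma sum_coords_path x w b : fpath alpha x w -> uniq (x :: w) ->
  alpha (last x w) \notin w ->
  sum_coords w (fun b => \prod_(j <- x :: w) entry b j) b =
  (\big[mulmx/1%:M]_(j <- x :: w) M j) (b x) (b (alpha (last x w))).
Proof.
elim: w x b => [|y w IH] x b /=.
  by rewrite !big_cons !big_nil mulmx1 mulr1.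
case/andP=> /eqP axy pw; rewrite inE negb_or -!andbA => /and4P[xy xw yw uw].
rewrite inE negb_or => /andP[zy zw].
rewrite big_cons mxE; apply: eq_bigr => v _.
under eq_sum_coords => b' do rewrite big_cons.
rewrite sum_coords_mull; last first.
  move=> b' j v' jw; rewrite /entry axy !ffunE.
  case: eqP => [e|_]; first by rewrite e jw in xw.
  by case: eqP => // e; rewrite e jw in yw.
rewrite IH ?pw //= ?yw ?uw // /entry axy !ffunE eqxx.
by rewrite (negPf xy) (negPf zy).
Qed.

Lemma cycle_wordP c : c \in porbits alpha ->
  exists x, c = porbit alpha x /\ cycle_word alpha c = traject alpha x #|c|.
Proof.
move=> /imsetP[y _ ->]; rewrite /cycle_word; case: pickP => [x|/(_ y)].
  by rewrite -eq_porbit_mem => /eqP <-; exists x.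
by rewrite porbit_id.
Qed.

Lemma mem_cycle_word c : c \in porbits alpha -> cycle_word alpha c =i c.
Proof.
by move=> /cycle_wordP[x [-> ->]] i; rewrite porbit_traject.
Qed.

Lemma uniq_cycle_word c : c \in porbits alpha -> uniq (cycle_word alpha c).
Proof. by move=> /cycle_wordP[x [-> ->]]; exact: uniq_traject_porbit. Qed.

(** On a cycle the path closes up: its two extreme indices are the same
    coordinate, and the last summation is a trace. *)
Lemma sum_coords_cycle c b : c \in porbits alpha ->
  sum_coords (cycle_word alpha c)
    (fun b => \prod_(j <- cycle_word alpha c) entry b j) b =
  \tr (\big[mulmx/1%:M]_(j <- cycle_word alpha c) M j).
Proof.
move=> cp; have := uniq_cycle_word cp; have [x [-> ->]] := cycle_wordP cp.
have := iter_porbit alpha x; have := card_porbit_neq0 alpha x.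
case: #|_| => [//|m] _ /= ix /andP[xw uw].
apply: eq_bigr => v _; rewrite sum_coords_path ?fpath_traject //= ?xw //.
  by rewrite last_traject -iterS /= ix ffunE eqxx.
by rewrite last_traject -iterS /= ix.
Qed.

Lemma cycle_words_disjoint c c' j : c \in porbits alpha -> c' \in porbits alpha ->
  j \in c -> j \in c' -> c = c'.
Proof.
move=> /imsetP[x _ ->] /imsetP[y _ ->]; rewrite -!eq_porbit_mem.
by move=> /eqP <- /eqP.
Qed.

(** Distinct cycles involve disjoint sets of coordinates, so that the sum of the
    product over the cycles splits. *)
Lemma sum_coords_cycles cs b : uniq cs -> {subset cs <= porbits alpha} ->
  sum_coords (flatten [seq cycle_word alpha c | c <- cs])
    (fun b => \prod_(c <- cs) \prod_(j <- cycle_word alpha c) entry b j) b =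
  \prod_(c <- cs) \tr (\big[mulmx/1%:M]_(j <- cycle_word alpha c) M j).
Proof.
elim: cs b => [|c cs IH] b /=; first by rewrite !big_nil.
case/andP=> ccs ucs scs.
have cp : c \in porbits alpha by apply: scs; rewrite mem_head.
have scs' : {subset cs <= porbits alpha}.
  by move=> c' c'cs; apply: scs; rewrite inE c'cs orbT.
rewrite sum_coords_cat big_cons -(sum_coords_cycle b cp) [RHS]mulrC.
rewrite -[RHS](@sum_coords_mull _ _ _ _ (fun=> _)) //.
apply: eq_sum_coords => b'.
under eq_sum_coords => b'' do rewrite big_cons.
rewrite sum_coords_mull ?IH // 1?mulrC //.
move=> b'' j v /flatten_mapP[c' c'cs jc']; rewrite big_seq [RHS]big_seq.
apply: eq_bigr => i; rewrite mem_cycle_word // => ic; rewrite mem_cycle_word ?scs' // in jc'.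
have jc : j \notin c.
  by apply: contra ccs => jc; rewrite (cycle_words_disjoint cp (scs' _ c'cs) jc jc').
rewrite /entry !ffunE; case: eqP => [e|_]; first by rewrite e (negPf jc) in ic.
case: eqP => // e; case/negP: jc; rewrite -e.
case/imsetP: cp ic => x _ ->; rewrite -!eq_porbit_mem.
by move=> /eqP <-; rewrite eq_porbit_mem -{1}(expg1 alpha) mem_porbit.
Qed.

(** The index form of a product of traces along cycles. The cycle structure has
    disappeared from the right-hand side, which is multilinear in the matrices and
    depends on [alpha] only through its values. *)
Lemma prod_cycle_traces : (0 < N)%N ->
  \prod_(c in porbits alpha) \tr (\big[mulmx/1%:M]_(j <- cycle_word alpha c) M j)
  = \sum_(b : {ffun 'I_n -> 'I_N}) \prod_j M j (b j) (b (alpha j)).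
Proof.
move=> N_gt0; have b0 : {ffun 'I_n -> 'I_N} := [ffun=> Ordinal N_gt0].
have sub c : c \in enum (porbits alpha) -> c \in porbits alpha by rewrite mem_enum.
rewrite -big_enum /= -(sum_coords_cycles b0) ?enum_uniq //.
rewrite sum_coords_full.
- apply: eq_bigr => b _.
  rewrite (partition_big (porbit alpha) (mem (porbits alpha))) /=; last first.
    by move=> j _; rewrite imset_f.
  rewrite big_enum; apply: eq_bigr => c cp; rewrite big_uniq ?uniq_cycle_word //=.
  apply: eq_bigl => j; rewrite mem_cycle_word //.
  by case/imsetP: cp => x _ ->; rewrite eq_porbit_mem.
- have : {subset enum (porbits alpha) <= porbits alpha} by [].
  elim: (enum _) (enum_uniq (porbits alpha)) => [//|c cs IH] /= /andP[ccs ucs] scs.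
  have cp : c \in porbits alpha by apply: scs; rewrite mem_head.
  have scs' : {subset cs <= porbits alpha}.
    by move=> c' c'cs; apply: scs; rewrite inE c'cs orbT.
  rewrite cat_uniq uniq_cycle_word // IH // andbT /=.
  apply/hasPn => j /flatten_mapP[c' c'cs]; rewrite mem_cycle_word ?scs' // => jc'.
  rewrite /= mem_cycle_word //.
  by apply: contra ccs => jc; rewrite (cycle_words_disjoint cp (scs' _ c'cs) jc jc').
- move=> j; apply/flatten_mapP; exists (porbit alpha j).
    by rewrite mem_enum imset_f.
  by rewrite mem_cycle_word ?imset_f ?porbit_id.
Qed.

End CycleTraceFormula.

(** * Polarization of colored sums of traces *)

(** Ryser's formula for the permanent. Once the products are expanded, a map [f]
    is counted with the alternating sum over the sets [S] that contain its image,
    and this sum vanishes unless [f] is onto, that is, a permutation. *)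
Lemma ryser (F : comNzRingType) (n : nat) (y : 'I_n -> 'I_n -> F) :
  \sum_(S : {set 'I_n}) (-1) ^+ #|~: S|%SET * \prod_j \sum_(i in S) y j i =
  \sum_(s : {perm 'I_n}) \prod_j y j (s j).
Proof.
have signE (f : {ffun 'I_n -> 'I_n}) :
    \sum_(S : {set 'I_n} | f \in ffun_on (mem S)) (-1) ^+ #|~: S|%SET
    = (injectiveb f)%:R :> F.
  pose A := [set f i | i : 'I_n]%SET.
  (* A product with a factor [1 - 1] for each point outside the image of [f];
     its expansion is the alternating sum. *)
  have -> : (injectiveb f)%:R = \prod_i ((1 : F) + - (i \notin A)%:R).
    have [/injectiveP finj|/injectivePn[i1 [i2 i12 fi12]]] := boolP (injectiveb f).
      rewrite big1 // => i _; rewrite (_ : i \in A) ?subr0 //.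
      suff /setP/(_ i) : A = [set: _]%SET by rewrite inE.
      by apply/eqP; rewrite eqEcard finset.subsetT card_imset ?cardsT //=.
    have /existsP[i iA] : [exists i, i \notin A].
      apply: contraT; rewrite negb_exists => /forallP/= AT.
      suff : (#|A| < #|'I_n|)%N.
        rewrite ltnNge => /negP[]; apply: subset_leq_card.
        by apply/fintype.subsetP => i _; move: (AT i); rewrite negbK.
      rewrite ltn_neqAle leq_imset_card andbT; apply: contra i12 => /finset.imset_injP/(_ i1 i2).
      by move=> /(_ isT isT fi12) ->.
    by rewrite (bigD1 i) //= iA subrr mul0r.
  rewrite bigA_distr [RHS](bigID (fun S : {set _} => f \in ffun_on (mem S))) /=.
  rewrite [X in _ = _ + X]big1 ?addr0 => [|S].
    apply: eq_bigr => S /ffun_onP fS.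
    rewrite (bigID (mem S)) /= big1 => [|i ->//]; rewrite mul1r.
    rewrite (eq_bigr (fun=> -1)) => [|i iS].
      by rewrite prodr_const; congr (_ ^+ _); apply: eq_card => i; rewrite !inE.
    rewrite (negPf iS) (_ : i \notin A) //.
    by apply: contra iS => /imsetP[j _ ->].
  move=> fS; have [i fi] : exists i, f i \notin S.
    apply/existsP; apply: contraR fS; rewrite negb_exists => /forallP/= fS.
    by apply/ffun_onP => i; move: (fS i); rewrite negbK.
  by rewrite (bigD1 (f i)) //= (negPf fi) imset_f //= oppr0 mul0r.
under eq_bigr => S _ do rewrite bigA_distr_big big_distrr /=.
rewrite (exchange_big_dep predT) //=.
under eq_bigr => f _ do rewrite -big_distrl /= signE.
rewrite (bigID (fun f : {ffun _} => injectiveb f)) /= addrC big1 ?add0r => [|f Uf]; last first.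
  by rewrite (negPf Uf) mul0r.
rewrite (reindex (@pval _)) /=; last first.
  pose in_Sn := insubd (1%g : 'S_n).
  by exists in_Sn => /= f Uf; first apply: val_inj; apply: insubdK.
apply: eq_big => /= [s | s _]; rewrite ?(valP s) // mul1r.
by apply: eq_bigr => j _; rewrite pvalE.
Qed.

Section ColoredTraceSums.
Context {F : comNzRingType} {s N : nat}.
Variable pc : 'I_s -> F.

Definition perm_trace (k : nat) (alpha : {perm 'I_k}) (M : 'I_k -> 'M[F]_N) : F :=
  \sum_(b : {ffun 'I_k -> 'I_N}) \prod_j M j (b j) (b (alpha j)).

(** The right-hand side of the moment formula, as a function of the [k] matrices
    that enter the traces. *)
Definition colored_trace_sum (k : nat) (t : 'I_k -> 'I_s) (M : 'I_k -> 'M[F]_N) : F :=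
  \sum_(alpha : {perm 'I_k} | [forall i, t i == t (alpha i)])
    orbit_prod (pc \o t) alpha * perm_trace alpha M.

End ColoredTraceSums.

Lemma reindex_ffun_perm (F : nmodType) (n : nat) (V : finType) (pi : {perm 'I_n})
    (G : {ffun 'I_n -> V} -> F) :
  \sum_(b : {ffun 'I_n -> V}) G b = \sum_(b : {ffun 'I_n -> V}) G [ffun i => b (pi i)].
Proof.
apply: (reindex (fun b : {ffun 'I_n -> V} => [ffun i => b (pi i)])).
apply: onW_bij; exists (fun b : {ffun 'I_n -> V} => [ffun i => b ((pi^-1)%g i)]) => b.
  by apply/ffunP => i; rewrite !ffunE permKV.
by apply/ffunP => i; rewrite !ffunE permK.
Qed.

Section ColoredTraceSumsTheory.
Context {F : comNzRingType} {s N : nat}.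
Variable pc : 'I_s -> F.

Lemma eq_perm_trace (k : nat) (alpha : {perm 'I_k}) (M M' : 'I_k -> 'M[F]_N) :
  M =1 M' -> perm_trace alpha M = perm_trace alpha M'.
Proof. by move=> MM'; apply: eq_bigr => b _; apply: eq_bigr => j _; rewrite MM'. Qed.

Lemma eq_colored_trace_sum (k : nat) (t : 'I_k -> 'I_s) (M M' : 'I_k -> 'M[F]_N) :
  M =1 M' -> colored_trace_sum pc t M = colored_trace_sum pc t M'.
Proof. by move=> MM'; apply: eq_bigr => alpha _; rewrite (eq_perm_trace _ MM'). Qed.

(** Cyclic invariance of the trace, for all the cycles at once. *)
Lemma perm_trace_mulC (k : nat) (alpha : {perm 'I_k}) (A B : 'I_k -> 'M[F]_N) :
  perm_trace alpha (fun j => A j *m B j) =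
  perm_trace alpha (fun j => B j *m A (alpha j)).
Proof.
rewrite /perm_trace.
transitivity (\sum_(b : {ffun 'I_k -> 'I_N}) \sum_(c : {ffun 'I_k -> 'I_N})
   (\prod_j A j (b j) (c j)) * \prod_j B j (c j) (b (alpha j))).
  apply: eq_bigr => b _.
  under eq_bigr => j _ do rewrite mxE.
  by rewrite bigA_distr_bigA /=; apply: eq_bigr => c _; rewrite big_split.
rewrite exchange_big /=; apply: eq_bigr => c _.
under [RHS]eq_bigr => j _ do rewrite mxE.
rewrite bigA_distr_bigA /= [LHS](reindex_ffun_perm alpha^-1%g); apply: eq_bigr => b _.
rewrite mulrC big_split /=; congr (_ * _).
  by apply: eq_bigr => j _; rewrite ffunE permK.
rewrite (reindex_inj (@perm_inj _ alpha)) /=.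
by apply: eq_bigr => j _; rewrite ffunE permK.
Qed.

(** A diagonal entry only occurs on the diagonal, so the index must be constant
    along the cycles. *)
Lemma perm_trace_diag (k : nat) (alpha : {perm 'I_k}) (l : 'I_k -> 'rV[F]_N) :
  perm_trace alpha (fun j => diag_mx (l j)) =
  \sum_(b : {ffun 'I_k -> 'I_N} | [forall i, b i == b (alpha i)])
    \prod_j l j 0 (b j).
Proof.
rewrite /perm_trace [RHS]big_mkcond; apply: eq_bigr => b _.
case: ifPn => [/forallP H|].
  by apply: eq_bigr => j _; have /eqP <- := H j; rewrite mxE eqxx mulr1n.
rewrite negb_forall => /existsP[j bj].
by rewrite (bigD1 j) //= mxE (negPf bj) mulr0n mul0r.
Qed.

(** A coloring [t] preserved by [alpha] together with an eigenvalue index constant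
    along the cycles of [alpha] is the same as a coloring by pairs preserved by
    [alpha]; the weight [pc] only sees the first component of the pair. *)
Lemma sum_colored_trace_diag (k : nat) (A B : 'I_s -> 'M[F]_N) (l : 'I_s -> 'rV[F]_N) :
  (forall r, B r *m A r = diag_mx (l r)) ->
  \sum_(t : {ffun 'I_k -> 'I_s}) colored_trace_sum pc t (fun j => A (t j) *m B (t j)) =
  \sum_(a : {ffun 'I_k -> 'I_s * 'I_N})
    color_sum (fun u => pc u.1) a * \prod_j l (a j).1 0 (a j).2.
Proof.
move=> BA.
pose pair2 (u : {ffun 'I_k -> 'I_s} * {ffun 'I_k -> 'I_N}) : {ffun 'I_k -> 'I_s * 'I_N} :=
  [ffun j => (u.1 j, u.2 j)].
rewrite (reindex pair2) /=; last first.
  apply: onW_bij; exists (fun a : {ffun _} => ([ffun j => (a j).1], [ffun j => (a j).2])).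
    by case=> t b; congr pair; apply/ffunP => j; rewrite !ffunE.
  by move=> a; apply/ffunP => j; rewrite !ffunE; case: (a j).
rewrite -(pair_bigA _ (fun t b => color_sum (fun u => pc u.1) (pair2 (t, b)) *
   \prod_j l (pair2 (t, b) j).1 0 (pair2 (t, b) j).2)) /=.
apply: eq_bigr => t _.
transitivity (\sum_(alpha : {perm 'I_k} | [forall i, t i == t (alpha i)])
   \sum_(b : {ffun 'I_k -> 'I_N} | [forall i, b i == b (alpha i)])
     orbit_prod (pc \o t) alpha * \prod_j l (t j) 0 (b j)).
  apply: eq_bigr => alpha /forallP ta; rewrite -big_distrr /= -perm_trace_diag.
  rewrite perm_trace_mulC; congr (_ * _); apply: eq_perm_trace => j.
  by have /eqP <- := ta j.
rewrite (exchange_big_dep predT) //=; apply: eq_bigr => b _.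
rewrite /color_sum big_distrl /=; apply: eq_big => [alpha|alpha _].
  apply/andP/forallP => [[/forallP ta /forallP ba] i|H].
    by rewrite !ffunE xpair_eqE ta ba.
  by split; apply/forallP => i; have := H i; rewrite !ffunE xpair_eqE => /andP[].
congr (_ * _); last by apply: eq_bigr => j _; rewrite !ffunE.
by congr orbit_prod; apply/funext => i /=; rewrite ffunE.
Qed.

(** Ryser's formula applied to each term of a form that is multilinear in the
    matrices. *)
Lemma colored_trace_sum_ryser (k : nat) (t : 'I_k -> 'I_s)
    (Y : 'I_k -> 'I_k -> 'M[F]_N) :
  \sum_(S : {set 'I_k}) (-1) ^+ #|~: S|%SET *
     colored_trace_sum pc t (fun j => \sum_(i in S) Y j i) =
  \sum_(pi : {perm 'I_k}) colored_trace_sum pc t (fun j => Y j (pi j)).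
Proof.
rewrite /colored_trace_sum.
under eq_bigr => S _ do rewrite big_distrr /=.
rewrite exchange_big [RHS]exchange_big /=; apply: eq_bigr => alpha _.
under eq_bigr => S _ do rewrite mulrCA.
rewrite -!big_distrr /=; congr (_ * _); rewrite /perm_trace.
under eq_bigr => S _ do rewrite big_distrr /=.
rewrite exchange_big [RHS]exchange_big /=; apply: eq_bigr => b _.
rewrite -(ryser (fun j i => Y j i (b j) (b (alpha j)))).
by apply: eq_bigr => S _; congr (_ * _); apply: eq_bigr => j _; rewrite summxE.
Qed.

(** Symmetry in the arguments: relabelling the points by [pi] relabels the
    coloring and conjugates [alpha], which keeps the number of cycles of each
    color. *)
Lemma sum_colored_trace_perm (k : nat) (pi : {perm 'I_k})
    (Y : 'I_k -> 'I_s -> 'M[F]_N) :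
  \sum_(t : {ffun 'I_k -> 'I_s}) colored_trace_sum pc t (fun j => Y (pi j) (t j)) =
  \sum_(t : {ffun 'I_k -> 'I_s}) colored_trace_sum pc t (fun j => Y j (t j)).
Proof.
rewrite (reindex_ffun_perm pi); apply: eq_bigr => t _.
rewrite /colored_trace_sum (reindex_inj (conjg_inj pi^-1%g)) /=.
have JE (alpha : {perm 'I_k}) i : (alpha ^ pi^-1)%g i = (pi^-1)%g (alpha (pi i)).
  by rewrite conjgE invgK !permM.
apply: eq_big => [alpha|alpha /forallP H].
  apply/forallP/forallP => H i.
    by have := H ((pi^-1)%g i); rewrite !ffunE JE !permKV.
  by rewrite !ffunE JE permKV.
congr (_ * _).
  rewrite -(orbit_prod_conj (P := pc \o t) (alpha := alpha) pi); last first.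
    move=> i /=; have := H ((pi^-1)%g i).
    by rewrite !ffunE JE !permKV => /eqP <-.
  by congr orbit_prod; apply/funext => i /=; rewrite ffunE.
rewrite /perm_trace (reindex_ffun_perm pi); apply: eq_bigr => b _.
rewrite [RHS](reindex_inj (@perm_inj _ pi)) /=.
by apply: eq_bigr => j _; rewrite !ffunE JE permKV.
Qed.

(** Any coloring other than [t0] picks a zero matrix somewhere. *)
Lemma sum_colored_trace_single (k : nat) (t0 : 'I_k -> 'I_s)
    (Z : 'I_k -> 'I_s -> 'M[F]_N) :
  \sum_(t : {ffun 'I_k -> 'I_s})
     colored_trace_sum pc t (fun j => if t0 j == t j then Z j (t j) else 0) =
  colored_trace_sum pc t0 (fun j => Z j (t0 j)).
Proof.
have t0E : t0 = [ffun j => t0 j] :> ('I_k -> 'I_s) by apply/funext => j; rewrite ffunE.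
rewrite (bigD1 [ffun j => t0 j]) //= [X in _ + X]big1 ?addr0 => [|t tt0].
  transitivity (colored_trace_sum pc [ffun j => t0 j] (fun j => Z j (t0 j))).
    by apply: eq_colored_trace_sum => j; rewrite ffunE eqxx.
  by rewrite -t0E.
have [j tj] : exists j, t0 j != t j.
  apply/existsP; apply: contraR tt0; rewrite negb_exists => /forallP/= H.
  by apply/eqP/ffunP => j; rewrite ffunE; have := H j; rewrite negbK => /eqP.
rewrite /colored_trace_sum big1 // => alpha _; rewrite /perm_trace big1 ?mulr0 // => b _.
by rewrite (bigD1 j) //= (negPf tj) mxE mul0r.
Qed.

(** Polarization: the values on the diagonal of a symmetric multilinear form
    determine all its values. The argument attached to [i] lives in the component
    [t0 i] only, which is how one coloring is isolated from the sum over all of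
    them. *)
Lemma colored_trace_sum_polarization (k : nat) (t0 : 'I_k -> 'I_s)
    (Z : 'I_k -> 'I_s -> 'M[F]_N) :
  \sum_(S : {set 'I_k}) (-1) ^+ #|~: S|%SET *
     \sum_(t : {ffun 'I_k -> 'I_s})
        colored_trace_sum pc t (fun j => \sum_(i in S | t0 i == t j) Z i (t j)) =
  k`!%:R * colored_trace_sum pc t0 (fun j => Z j (t0 j)).
Proof.
pose Y i r := if t0 i == r then Z i r else 0.
under eq_bigr => S _.
  rewrite big_distrr /=; under eq_bigr => t _.
    rewrite (@eq_colored_trace_sum _ _ _ (fun j => \sum_(i in S) Y i (t j))); last first.
      by move=> j; rewrite -big_mkcondr.
    over.
  over.
rewrite exchange_big /=.
under eq_bigr => t _ do rewrite (colored_trace_sum_ryser t (fun j i => Y i (t j))).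
rewrite exchange_big /=.
under eq_bigr => pi _ do rewrite (sum_colored_trace_perm pi Y) sum_colored_trace_single.
by rewrite sumr_const card_Sn mulr_natl.
Qed.

Lemma colored_trace_sum_multilinear (k : nat) (E : finType) (t : 'I_k -> 'I_s)
    (c : 'I_k -> E -> F) (H : 'I_k -> E -> 'M[F]_N) :
  colored_trace_sum pc t (fun j => \sum_e c j e *: H j e) =
  \sum_(eps : {ffun 'I_k -> E}) (\prod_j c j (eps j)) *
    colored_trace_sum pc t (fun j => H j (eps j)).
Proof.
rewrite /colored_trace_sum.
under [RHS]eq_bigr => eps _ do rewrite big_distrr /=.
rewrite [RHS]exchange_big /=; apply: eq_bigr => alpha _.
under [RHS]eq_bigr => eps _ do rewrite mulrCA.
rewrite -big_distrr /=; congr (_ * _); rewrite /perm_trace.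
under [RHS]eq_bigr => eps _ do rewrite big_distrr /=.
rewrite [RHS]exchange_big /=; apply: eq_bigr => b _.
under eq_bigr => j _ do rewrite summxE.
rewrite bigA_distr_bigA /=; apply: eq_bigr => eps _.
by rewrite -big_split /=; apply: eq_bigr => j _; rewrite mxE.
Qed.

Lemma q_perm_trace (n : nat) (sigma : {perm 'I_n}) (t : 'I_n -> 'I_s)
    (h : 'I_n -> 'M[F]_N) (x : 'I_s -> 'M[F]_N) : (0 < N)%N ->
  q sigma t h x = perm_trace sigma (fun j => h j *m x (t j)).
Proof. by move=> N0; rewrite /q prod_cycle_traces. Qed.

Lemma delta_mulmxE (A : 'M[F]_N) (u v i j : 'I_N) :
  (delta_mx u v *m A) i j = (i == u)%:R * A v j.
Proof.
rewrite mxE (bigD1 v) //= big1 ?addr0 => [|l lv]; first by rewrite mxE eqxx andbT.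
by rewrite mxE (negPf lv) andbF mul0r.
Qed.

Lemma tr_delta_mulmx (A : 'M[F]_N) (u v : 'I_N) : \tr (delta_mx u v *m A) = A v u.
Proof.
rewrite /mxtrace (bigD1 u) //= big1 ?addr0 => [|i iu].
  by rewrite delta_mulmxE eqxx mul1r.
by rewrite delta_mulmxE (negPf iu) mul0r.
Qed.

(** Matrix units extract single entries; this writes an entry polynomial as a
    combination of products of traces. *)
Lemma perm_trace_expand (n : nat) (sigma : {perm 'I_n}) (M : 'I_n -> 'M[F]_N) :
  perm_trace sigma M = \sum_(b : {ffun 'I_n -> 'I_N})
    \prod_j \tr (delta_mx (b (sigma j)) (b j) *m M j).
Proof.
by apply: eq_bigr => b _; apply: eq_bigr => j _; rewrite tr_delta_mulmx.
Qed.

(** The matrix units force the inner index function to be [b \o sigma], and thereby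
    compose [alpha] with [sigma]. *)
Lemma perm_trace_compose (n : nat) (sigma alpha : {perm 'I_n}) (M : 'I_n -> 'M[F]_N) :
  \sum_(b : {ffun 'I_n -> 'I_N})
    perm_trace alpha (fun j => delta_mx (b (sigma j)) (b j) *m M j) =
  perm_trace (alpha * sigma)%g M.
Proof.
apply: eq_bigr => b _; rewrite /perm_trace (bigD1 [ffun j => b (sigma j)]) //=.
rewrite [X in _ + X]big1 ?addr0 => [|c cb].
  by apply: eq_bigr => j _; rewrite delta_mulmxE !ffunE eqxx mul1r permM.
have [j cj] : exists j, c j != b (sigma j).
  apply/existsP; apply: contraR cb; rewrite negb_exists => /forallP/= H.
  by apply/eqP/ffunP => j; rewrite ffunE; have := H j; rewrite negbK => /eqP.
by rewrite (bigD1 j) //= delta_mulmxE (negPf cj) !mul0r.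
Qed.

End ColoredTraceSumsTheory.

(** * Moments from a Laplace transform *)

Section MomentGeneratingFunction.
Local Open Scope classical_set_scope.
Local Open Scope ring_scope.
Import numFieldNormedType.Exports.
Context {d : measure_display} {T : measurableType d} {R : realType}.
Variable P : probability T R.

(** From [y <= expR y]. *)
Lemma exprn_le_expR (k : nat) (c : R) : 0 < c ->
  exists2 C, 0 <= C & forall y : R, `|y| ^+ k <= C * expR (c * `|y|).
Proof.
(* Dividing by [k.+1] rather than [k] also covers the case [k = 0]. *)
move=> c0; pose a := c / k.+1%:R; have a0 : 0 < a by rewrite divr_gt0.
exists (a ^- k); first by rewrite invr_ge0 exprn_ge0 // ltW.
move=> y; rewrite ler_pdivlMl ?exprn_gt0 // -exprMn.
apply: (@le_trans _ _ (expR (a * `|y|) ^+ k)).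
  have ay : 0 <= a * `|y| by apply: mulr_ge0 => //; exact: ltW.
  rewrite lerXn2r ?nnegrE ?expR_ge0 //.
  by apply: le_trans (expR_ge1Dx _); rewrite lerDr.
rewrite -expRM_natl ler_expR mulrA ler_wpM2r // /a mulrCA.
by rewrite ler_piMr ?(ltW c0) // ler_pdivrMr // mul1r ler_nat.
Qed.

Lemma expR_norm_le (b y : R) : expR (b * `|y|) <= expR (b * y) + expR (- b * y).
Proof.
case: (ger0P y) => _; first by rewrite lerDl expR_ge0.
by rewrite mulrN mulNr lerDr expR_ge0.
Qed.

Variables (X : T -> R) (e : R) (g : nat -> R -> R).
Hypothesis mX : measurable_fun setT X.
Hypothesis e_gt0 : 0 < e.
Hypothesis mgf0 : forall x : R, `|x| < e ->
  (\int[P]_w (expR (x * X w))%:E)%E = (g 0 x)%:E.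

Lemma integrable_expRM (x : R) : `|x| < e ->
  P.-integrable setT (EFin \o (fun w => expR (x * X w))).
Proof.
move=> xe; apply/integrableP; split.
  apply/measurable_EFinP; apply: measurableT_comp => //.
  exact: measurable_funM.
under eq_integral => w _ do rewrite /= ger0_norm ?expR_ge0 //.
by rewrite mgf0 // ltry.
Qed.

(** One integrable bound for all the parameters [x] in a compact subinterval:
    half of the margin left below [e] absorbs the polynomial factor. *)
Lemma moment_domination (k : nat) (b : R) : 0 <= b < e ->
  exists G : T -> R, [/\ forall w, 0 <= G w, P.-integrable setT (EFin \o G) &
    forall (x : R) w, `|x| <= b -> `|X w ^+ k * expR (x * X w)| <= G w].
Proof.
move=> /andP[b0 be]; pose c := (e - b) / 2.
have c0 : 0 < c by rewrite divr_gt0 // subr_gt0.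
have [C C0 HC] := @exprn_le_expR k c c0.
exists (fun w => C * (expR ((b + c) * X w) + expR (- (b + c) * X w))); split.
- by move=> w; rewrite mulr_ge0 // addr_ge0 // expR_ge0.
- have bce : `|b + c| < e.
    rewrite ger0_norm ?addr_ge0 ?(ltW c0) // /c; lra.
  have := integrableZl measurableT C (integrableD measurableT
    (integrable_expRM bce) (integrable_expRM (x := - (b + c)) _)).
  by rewrite normrN => /(_ bce).
- move=> x w xb; rewrite normrM normrX [`|expR _|]ger0_norm ?expR_ge0 //.
  apply: le_trans (ler_wpM2l C0 (expR_norm_le _ _)).
  rewrite [b + c]addrC mulrDl expRD mulrA ler_pM ?expR_ge0 ?exprn_ge0 //.
  rewrite ler_expR (le_trans (ler_norm _)) // normrM ler_wpM2r //.
Qed.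

Lemma integrable_moment k (x : R) : `|x| < e ->
  P.-integrable setT (EFin \o (fun w => X w ^+ k * expR (x * X w))).
Proof.
move=> xe; have [|G [G0 iG HG]] := @moment_domination k `|x|; first by rewrite normr_ge0.
apply: (@le_integrable _ _ _ _ _ _ _ (EFin \o G)) => //.
- apply/measurable_EFinP; apply: measurable_funM; first exact: measurable_funX.
  by apply: measurableT_comp => //; exact: measurable_funM.
- by move=> w _ /=; rewrite lee_fin [leRHS]ger0_norm // HG.
Qed.

(** Differentiation under the integral sign. *)
Lemma is_derive_moment k (x : R) : `|x| < e ->
  is_derive x (1 : R) (fun x : R => \int[P]_w (X w ^+ k * expR (x * X w)))%R
    (\int[P]_w (X w ^+ k.+1 * expR (x * X w)))%R.
Proof.
move=> xe; pose b := (`|x| + e) / 2.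
have b0e : 0 <= b < e by have := normr_ge0 x; rewrite /b; lra.
have xb : `|x| < b by rewrite /b; lra.
have [G [G0 iG HG]] := moment_domination k.+1 b0e.
pose f (x : R) (w : T) := X w ^+ k * expR (x * X w).
have df (y : R) (w : T) : is_derive y (1 : R) (f ^~ w) (X w ^+ k.+1 * expR (y * X w)).
  rewrite /f; apply: is_derive_eq.
  rewrite scaler0 add0r exprSr.
  by rewrite -[LHS]/(X w ^+ k * (expR (y * X w) * (X w * 1))); ring.
have d1f (y : R) (w : T) : partial1of2 f y w = X w ^+ k.+1 * expR (y * X w).
  by rewrite partial1of2E; apply: derive_val.
have Ix : `]- b, b[%classic x by rewrite /= in_itv /= -ltr_norml.
have intf (y : R) : `]- b, b[%classic y -> P.-integrable setT (EFin \o f y).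
  rewrite /= in_itv /= -ltr_norml => yb; apply: integrable_moment.
  by case/andP: b0e => _; apply: lt_trans.
have derf (y : R) (w : T) : `]- b, b[%classic y -> [set: T] w -> derivable (f ^~ w) y 1.
  by move=> _ _; apply: ex_derive.
have Gub (y : R) (w : T) : `]- b, b[%classic y -> [set: T] w -> `|partial1of2 f y w| <= G w.
  rewrite /= in_itv /= -ltr_norml => yb _; rewrite d1f HG //; exact: ltW.
apply: DeriveDef.
  exact: (@derivable_under_integral _ _ _ P f _ measurableT x _ _ Ix intf derf G).
rewrite -derive1E.
rewrite (@differentiation_under_integral _ _ _ P f _ measurableT x _ _ Ix intf derf G) //.
by apply: eq_Rintegral => w _; rewrite d1f.
Qed.

Hypothesis dg : forall k (x : R), `|x| < e -> is_derive x (1 : R) (g k) (g k.+1 x).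

(** The two sides agree on a neighbourhood for [k] by induction, hence so do their
    derivatives, which are the two sides for [k.+1]. *)
Lemma mgf_moment_near k (x : R) : `|x| < e ->
  (\int[P]_w (X w ^+ k * expR (x * X w)))%R = g k x.
Proof.
elim: k x => [|k IH] x xe.
  rewrite /Rintegral; under eq_integral do rewrite expr0 mul1r.
  by rewrite mgf0.
have /@derive_val <- := is_derive_moment k xe.
have /@derive_val <- := dg k xe.
apply: near_eq_derive.
have : nbhs x (ball x (e - `|x|)) by apply: nbhsx_ballx; rewrite subr_gt0.
apply: filterS => y; rewrite /ball /= => xy; apply: IH.
rewrite -(subrK x y) (le_lt_trans (ler_normD _ _)) // distrC; lra.
Qed.

Lemma mgf_moments k :
  P.-integrable setT (EFin \o (fun w => X w ^+ k)) /\
  (\int[P]_w (X w ^+ k))%R = g k 0.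
Proof.
have z : `|0 : R| < e by rewrite normr0.
have E w : X w ^+ k * expR (0 * X w) = X w ^+ k by rewrite mul0r expR0 mulr1.
split; last by rewrite -mgf_moment_near //; apply: eq_Rintegral => w _; rewrite E.
by have := integrable_moment k z; under eq_fun do rewrite E.
Qed.

End MomentGeneratingFunction.

(** * Derivatives of products of powers *)

Section ConsFfun.
Context {I : finType}.

Definition cons_ffun k (u : I * {ffun 'I_k -> I}) : {ffun 'I_k.+1 -> I} :=
  [ffun i => if unlift ord0 i is Some j then u.2 j else u.1].

Lemma cons_ffun0 k (u : I * {ffun 'I_k -> I}) : cons_ffun u ord0 = u.1.
Proof. by rewrite ffunE unlift_none. Qed.

Lemma cons_ffun_lift k (u : I * {ffun 'I_k -> I}) j :
  cons_ffun u (lift ord0 j) = u.2 j.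
Proof. by rewrite ffunE liftK. Qed.

Lemma cons_ffun_bij k : bijective (@cons_ffun k).
Proof.
exists (fun a : {ffun 'I_k.+1 -> I} => (a ord0, [ffun j : 'I_k => a (lift ord0 j)])) => [[i a]|a].
  congr pair; first exact: cons_ffun0.
  by apply/ffunP => j; rewrite ffunE cons_ffun_lift.
apply/ffunP => i; case: (unliftP ord0 i) => [j ->|->].
  by rewrite cons_ffun_lift ffunE.
by rewrite cons_ffun0.
Qed.

Lemma color_sum_cons (F : comNzRingType) (p : I -> F) k (u : I * {ffun 'I_k -> I}) :
  color_sum p (cons_ffun u) = (p u.1 + \sum_(l < k) (u.2 l == u.1)%:R) * color_sum p u.2.
Proof.
rewrite color_sum_rec cons_ffun0; congr (_ * _).
  by congr (_ + _); apply: eq_bigr => l _; rewrite cons_ffun_lift.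
by congr color_sum; apply/funext => j /=; rewrite cons_ffun_lift.
Qed.

Lemma color_sum_nil (F : comNzRingType) (p : I -> F) (a : 'I_0 -> I) :
  color_sum p a = 1.
Proof.
rewrite /color_sum (big_pred1 1%g) => [|alpha].
  rewrite /orbit_prod /porbits big1 // => c /imsetP[[]//].
have -> : alpha = 1%g by apply/permP => -[].
by rewrite /= eqxx; apply/forallP => -[].
Qed.

End ConsFfun.

Section ProductPowerDerivatives.
Context {R : realType} {I : finType}.
Variables (lam p : I -> R).

(** Logarithmic differentiation, stated without dividing by the factors. *)
Lemma is_derive_prod_log (J : Type) (s : seq J) (f : J -> R -> R) (c : J -> R) (x : R) :
  (forall j, is_derive x (1 : R) (f j) (f j x * c j)) ->
  is_derive x (1 : R) (fun y => \prod_(j <- s) f j y)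
    ((\prod_(j <- s) f j x) * \sum_(j <- s) c j).
Proof.
move=> df; elim: s => [|j s IH].
  rewrite !big_nil mulr0; under eq_fun do rewrite big_nil.
  exact: is_derive_cst.
under eq_fun do rewrite big_cons.
rewrite !big_cons; apply: is_derive_eq.
rewrite /GRing.scale /=; ring.
Qed.

Lemma is_derive_sum_seq (J : Type) (s : seq J) (f : J -> R -> R) (df : J -> R) (x : R) :
  (forall j, is_derive x (1 : R) (f j) (df j)) ->
  is_derive x (1 : R) (fun y => \sum_(j <- s) f j y) (\sum_(j <- s) df j).
Proof.
move=> dfj; elim: s => [|j s IH].
  rewrite !big_nil; under eq_fun do rewrite big_nil.
  exact: is_derive_cst.
under eq_fun do rewrite big_cons.
by rewrite !big_cons; apply: is_derive_eq.
Qed.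

(** Minus the logarithmic derivative of [1 - x * lam i]. Under the probability
    with density proportional to [expR (x * X)] it plays the role that [lam i]
    plays for the original one. *)
Definition tilted (i : I) (x : R) : R := lam i / (1 - x * lam i).

Definition prod_powers (x : R) : R := \prod_(i : I) (1 - x * lam i) `^ (- p i).

(** A closed form of the [k]-th derivative of [prod_powers]. *)
Definition prod_powers_derivative (k : nat) (x : R) : R :=
  prod_powers x *
  \sum_(a : {ffun 'I_k -> I}) color_sum p a * \prod_(j < k) tilted (a j) x.

Lemma is_derive_affine (i : I) (x : R) :
  is_derive x (1 : R) (fun y : R => 1 - y * lam i) (- lam i).
Proof.
apply: is_derive_eq.
rewrite scaler0 add0r.
by rewrite mul1r add0r; congr (- _); exact: mulr1.
Qed.

Lemma is_derive_tilted (i : I) (x : R) : 0 < 1 - x * lam i ->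
  is_derive x (1 : R) (tilted i) (tilted i x * tilted i x).
Proof.
move=> xi; have dxi := is_derive_affine i x.
have nz : 1 - x * lam i != 0 by rewrite gt_eqF.
have dV := @is_deriveV _ (fun y => 1 - y * lam i) _ _ _ nz dxi.
rewrite /tilted; apply: is_derive_eq.
rewrite /GRing.scale /=; field.
exact: nz.
Qed.

Lemma is_derive_power (i : I) (x : R) : 0 < 1 - x * lam i ->
  is_derive x (1 : R) (fun y : R => (1 - y * lam i) `^ (- p i))
    ((1 - x * lam i) `^ (- p i) * (p i * tilted i x)).
Proof.
move=> xi; have dxi := is_derive_affine i x.
have dp := is_derive1_powR (- p i) xi.
have := @is_derive1_comp _ (fun z : R => z `^ (- p i)) (fun y => 1 - y * lam i) _ _ _ dp dxi.
move=> H; apply: is_derive_eq.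
rewrite powRB ?(gt_eqF xi) ?implybT // powRr1 ?ltW // /GRing.scale /= /tilted.
by field; rewrite gt_eqF.
Qed.

(** Since the derivative of [tilted i] is its square, differentiating the product
    over [j] repeats once each of its factors, while differentiating [prod_powers]
    brings out [p i * tilted i] for each [i]. Together a new factor [tilted i]
    comes with the coefficient [p i] plus the number of previous occurrences of
    [i], which is the recursion [color_sum_cons]. *)
Lemma is_derive_prod_powers_derivative k x : (forall i, 0 < 1 - x * lam i) ->
  is_derive x (1 : R) (prod_powers_derivative k) (prod_powers_derivative k.+1 x).
Proof.
move=> xi.
have dP : is_derive x (1 : R) prod_powers
    (prod_powers x * \sum_(i : I) (p i * tilted i x)).
  exact: is_derive_prod_log (fun i => is_derive_power (xi i)).
have dS : is_derive x (1 : R) (fun y =>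
     \sum_(a : {ffun 'I_k -> I}) color_sum p a * \prod_(j < k) tilted (a j) y)
   (\sum_(a : {ffun 'I_k -> I}) color_sum p a *
      (\prod_(j < k) tilted (a j) x * \sum_(j < k) tilted (a j) x)).
  apply: is_derive_sum_seq => a.
  have dprod := is_derive_prod_log (index_enum 'I_k) (fun j => is_derive_tilted (xi (a j))).
  by apply: is_derive_eq.
apply: is_derive_eq.
rewrite /prod_powers_derivative.
set f := prod_powers x.
rewrite (reindex _ (onW_bij _ (@cons_ffun_bij I k))) /=.
under [in RHS]eq_bigr => u _.
  rewrite color_sum_cons big_ord_recl cons_ffun0.
  under [X in _ * (_ * X)]eq_bigr => j _ do rewrite cons_ffun_lift.
  over.
rewrite -(pair_bigA _ (fun i (a : {ffun 'I_k -> I}) =>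
   (p i + \sum_(l < k) (a l == i)%:R) * color_sum p a *
   (tilted i x * \prod_(j < k) tilted (a j) x))) /=.
rewrite exchange_big /= /GRing.scale /=.
rewrite [X in _ + X]mulrCA -mulrDr; congr (_ * _).
rewrite big_distrl -big_split /=; apply: eq_bigr => a _.
(* Collect the occurrences of each color in [a]. *)
have -> : \sum_(j < k) tilted (a j) x =
    \sum_(i : I) (\sum_(l < k) (a l == i)%:R) * tilted i x.
  under [RHS]eq_bigr => i _ do rewrite big_distrl /=.
  rewrite exchange_big /=; apply: eq_bigr => j _.
  rewrite (bigD1 (a j)) //= eqxx mul1r big1 ?addr0 // => i ij.
  by rewrite eq_sym (negPf ij) mul0r.
rewrite mulrA -mulrDr -big_split big_distrr /=.
by apply: eq_bigr => i _; ring.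
Qed.

Lemma prod_powers_derivative0 k :
  prod_powers_derivative k 0 =
  \sum_(a : {ffun 'I_k -> I}) color_sum p a * \prod_(j < k) lam (a j).
Proof.
rewrite /prod_powers_derivative /prod_powers big1 ?mul1r => [|i _].
  apply: eq_bigr => a _; congr (_ * _); apply: eq_bigr => j _.
  by rewrite /tilted mul0r subr0 divr1.
by rewrite mul0r subr0 powR1.
Qed.

Lemma prod_powers_derivative_nil x : prod_powers_derivative 0 x = prod_powers x.
Proof.
rewrite /prod_powers_derivative (big_pred1 (ffun0 (card_ord 0))) => [|a].
  by rewrite color_sum_nil big_ord0 !mulr1.
by apply/esym/eqP/ffunP => -[].
Qed.

Lemma small_scaling : exists2 e : R, 0 < e &
  forall x : R, `|x| < e -> forall i, 0 < 1 - x * lam i.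
Proof.
have s0 : 0 < 1 + \sum_(i : I) `|lam i| by rewrite ltr_wpDr // sumr_ge0.
exists (1 + \sum_(i : I) `|lam i|)^-1; first by rewrite invr_gt0.
move=> x xe i; rewrite subr_gt0 (le_lt_trans (ler_norm _)) // normrM.
have li : `|lam i| <= 1 + \sum_(i : I) `|lam i|.
  by rewrite (bigD1 i) //= addrCA lerDl addr_ge0 // sumr_ge0.
by rewrite (le_lt_trans (ler_wpM2l _ li)) // -ltr_pdivlMr // mul1r.
Qed.

Lemma prod_powers_moments (d : measure_display) (T : measurableType d)
    (P : probability T R) (X : T -> R) (k : nat) :
  measurable_fun setT X ->
  (forall x : R, (forall i, 0 < 1 - x * lam i) ->
    (\int[P]_w (expR (x * X w))%:E)%E = (prod_powers x)%:E) ->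
  P.-integrable setT (EFin \o (fun w => X w ^+ k)) /\
  (\int[P]_w (X w ^+ k))%R =
    \sum_(a : {ffun 'I_k -> I}) color_sum p a * \prod_(j < k) lam (a j).
Proof.
move=> mX mgfX; have [e e0 He] := small_scaling.
rewrite -prod_powers_derivative0; apply: (@mgf_moments _ _ _ P X e) => // [x xe|k' x xe].
  by rewrite mgfX ?prod_powers_derivative_nil //; exact: He.
by apply: is_derive_prod_powers_derivative; exact: He.
Qed.

End ProductPowerDerivatives.

(** * Expectations of products of independent variables *)

Section IndependentProducts.
Local Open Scope classical_set_scope.
Local Open Scope ereal_scope.
Local Open Scope ring_scope.
Import HBNNSimple.

Section WeightedIntegrals.
Context {d d' : measure_display} {T : measurableType d} {T' : measurableType d'}
  {R : realType}.
Variables (mu : {measure set T -> \bar R}) (f : T -> T').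
Hypothesis mf : measurable_fun setT f.

Let weighted (K : T -> R) (Y : T' -> R) : \bar R :=
  (\int[mu]_x (Y (f x) * K x)%:E)%E.

(** Linearity, for a function with finitely many values. *)
Lemma weighted_integral_nnsfun (K : T -> R) (h : {nnsfun T' >-> R}) :
  measurable_fun setT K -> (forall x, 0 <= K x) ->
  weighted K h =
  (\sum_(y \in range h) (y%:E * weighted K \1_(h @^-1` [set y])))%E.
Proof.
move=> mK K0; rewrite /weighted.
have mi y : measurable_fun setT (fun x => (\1_(h @^-1` [set y]) (f x) : R)).
  have mI : measurable_fun setT (\1_(h @^-1` [set y]) : T' -> R).
    exact: measurable_indic.
  exact: (measurableT_comp mI mf).
have hfin := fimfunP h.
transitivity (\int[mu]_x (\sum_(y <- finmap.enum_fset (fset_set (range h)))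
    (y%:E * (\1_(h @^-1` [set y]) (f x) * K x)%:E)))%E.
  apply: eq_integral => x _; rewrite [in LHS]fimfunE fsbig_finite // big_distrl /=.
  by rewrite -sumEFin; apply: eq_bigr => y _; rewrite -mulrA EFinM.
rewrite fsbig_finite // ge0_integral_sum //.
- apply: eq_big_seq => y; rewrite in_fset_set // inE => -[x _ <-].
  rewrite ge0_integralZl_EFin //.
  + by move=> x' _; rewrite lee_fin mulr_ge0.
  + by apply/measurable_EFinP; exact: measurable_funM.
- move=> y; apply: measurable_funeM; apply/measurable_EFinP.
  exact: measurable_funM.
- move=> y x _; rewrite indicE; case: (boolP (_ \in _)) => [|_].
  + by rewrite inE /= => <-; rewrite -EFinM lee_fin !mulr_ge0.
  + by rewrite mul0r mule0.
Qed.

Lemma weighted_integral_lim (K : T -> R) (Y : T' -> R)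
    (mY : measurable_fun setT (EFin \o Y)) :
  measurable_fun setT K -> (forall x, 0 <= K x) -> (forall x, 0 <= Y x) ->
  weighted K Y = limn (fun n => weighted K (nnsfun_approx measurableT mY n)).
Proof.
move=> mK K0 Y0; rewrite /weighted; set h := nnsfun_approx measurableT mY.
rewrite -monotone_convergence //.
- apply: eq_integral => x _; apply/esym/cvg_lim => //.
  rewrite EFinM; under eq_fun do rewrite EFinM.
  apply: cvgeZr => //; apply: cvg_nnsfun_approx => //.
  by move=> y _; rewrite lee_fin.
- move=> n; apply/measurable_EFinP; apply: measurable_funM => //.
  by apply: measurableT_comp.
- by move=> n x _; rewrite lee_fin mulr_ge0.
- move=> x _ n m nm; rewrite lee_fin ler_wpM2r //.
  exact/lefP/nd_nnsfun_approx.
Qed.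

(** The hypothesis says that [K1] and [K2] have the same conditional expectation
    given [f]. It extends from indicators to nonnegative functions by linearity and
    monotone convergence. *)
Lemma eq_weighted_integral (K1 K2 : T -> R) (Y : T' -> R) :
  measurable_fun setT K1 -> measurable_fun setT K2 ->
  (forall x, 0 <= K1 x) -> (forall x, 0 <= K2 x) ->
  measurable_fun setT Y -> (forall x, 0 <= Y x) ->
  (forall A : set T', measurable A -> (\int[mu]_x (\1_A (f x) * K1 x)%:E
     = \int[mu]_x (\1_A (f x) * K2 x)%:E)%E) ->
  (\int[mu]_x (Y (f x) * K1 x)%:E = \int[mu]_x (Y (f x) * K2 x)%:E)%E.
Proof.
move=> mK1 mK2 K10 K20 mY Y0 K12.
have mY' : measurable_fun setT (EFin \o Y) by exact/measurable_EFinP.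
rewrite -/(weighted K1 Y) -/(weighted K2 Y) !(weighted_integral_lim mY') //.
congr (limn _); apply/funext => n; rewrite !weighted_integral_nnsfun //.
by apply: eq_fsbigr => y _; congr (_ * _)%E; exact: K12.
Qed.

End WeightedIntegrals.

Section ProductRule.
Context {d : measure_display} {T : measurableType d} {R : realType}.
Variables (P : probability T R) (s : nat) (X : 'I_s -> T -> R).
Hypothesis mX : forall r, measurable_fun setT (X r).
Hypothesis indep_X : forall B : 'I_s -> set R, (forall r, measurable (B r)) ->
  P (\bigcap_(r in setT) X r @^-1` B r) = (\prod_(r < s) P (X r @^-1` B r))%E.

(** Induction on the set [J] of the indices whose function is not known to be an
    indicator, starting from the independence of the events. The induction
    hypothesis, used with one function replaced by indicators, says that the
    product of the other ones may be replaced by the constant [c] when it is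
    integrated against a function of the remaining variable. *)
Let independent_product_rule (k : nat) (J : {set 'I_s}) (phi : 'I_s -> R -> R) :
  #|J| = k ->
  (forall r x, 0 <= phi r x) -> (forall r, measurable_fun setT (phi r)) ->
  (forall r, \int[P]_w (phi r (X r w))%:E < +oo)%E ->
  (forall r, r \notin J -> exists2 B, measurable B & phi r = \1_B) ->
  (\int[P]_w (\prod_(r < s) phi r (X r w))%:E =
   \prod_(r < s) \int[P]_w (phi r (X r w))%:E)%E.
Proof.
elim: k J phi => [|k IH] J phi cardJ phi0 mphi phifin phiJ.
  have /fin_all_exists2[B mB phiB] : forall r, exists2 B, measurable B & phi r = \1_B.
    by move=> r; apply: phiJ; rewrite (cards0_eq cardJ) inE.
  have mXB r : measurable (X r @^-1` B r).
    by rewrite -[_ @^-1` _]setTI; exact: mX.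
  have -> : (\int[P]_w (\prod_(r < s) phi r (X r w))%:E =
      \int[P]_w (\1_(\bigcap_(r in setT) X r @^-1` B r) w)%:E)%E.
    apply: eq_integral => w _; congr EFin; rewrite indicE.
    case: (boolP (_ \in _)) => [|]; rewrite ?inE.
      move=> wB; rewrite big1 // => r _; rewrite phiB indicE mem_set //.
      exact: (wB r I).
    move=> nwB; have [r] : exists r, ~ B r (X r w).
      by apply/existsNP => wB; apply/negP: nwB; rewrite negbK inE => r _; exact: wB.
    by move=> nB; rewrite (bigD1 r) //= phiB indicE memNset // mul0r.
  rewrite integral_indic //; last exact: fin_bigcap_measurable.
  rewrite classical_sets.setIT; etransitivity; first exact: (indep_X mB).
  apply: eq_bigr => r _.
  under eq_integral => w _ do rewrite phiB -[\1__ _]/(\1_(X r @^-1` B r) w).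
  by rewrite integral_indic // classical_sets.setIT.
have [r0 r0J] : exists r, r \in J by apply/set0Pn; rewrite -card_gt0 cardJ.
pose K1 w := \prod_(r < s | r != r0) phi r (X r w).
pose c := \prod_(r < s | r != r0) fine (\int[P]_w (phi r (X r w))%:E)%E.
have cE : (\prod_(r < s | r != r0) \int[P]_w (phi r (X r w))%:E = c%:E)%E.
  rewrite -prodEFin; apply: eq_bigr => r _; rewrite fineK // ge0_fin_numE //.
  by apply: integral_ge0 => w _; rewrite lee_fin.
have c0 : 0 <= c.
  by apply: prodr_ge0 => r _; apply/fine_ge0/integral_ge0 => w _; rewrite lee_fin.
have mphiX r : measurable_fun setT (fun w => phi r (X r w)) by exact: measurableT_comp.
have K10 w : 0 <= K1 w by apply: prodr_ge0.
have mK1 : measurable_fun setT K1.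
  rewrite /K1; under eq_fun do rewrite -big_filter.
  by apply: measurable_prod.
have intc (Y : R -> R) : measurable_fun setT Y -> (forall x, 0 <= Y x) ->
    (\int[P]_w (Y (X r0 w) * c)%:E = \int[P]_w (Y (X r0 w))%:E * c%:E)%E.
  move=> mY Y0; under eq_integral do rewrite EFinM.
  rewrite ge0_integralZr //; last by move=> w _; rewrite lee_fin.
  by apply/measurable_EFinP; exact: measurableT_comp.
transitivity (\int[P]_w (phi r0 (X r0 w) * c)%:E)%E; last first.
  by rewrite intc // [RHS](bigD1 r0) //= cE.
transitivity (\int[P]_w (phi r0 (X r0 w) * K1 w)%:E)%E.
  by apply: eq_integral => w _; rewrite (bigD1 r0).
apply: eq_weighted_integral => // A mA.
pose phi' r := if r == r0 then \1_A else phi r.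
have := IH (J :\ r0)%SET phi'; rewrite (bigD1 r0) //= /phi' eqxx.
under eq_integral => w _.
  rewrite (bigD1 r0) //= eqxx.
  under eq_bigr => r /negPf -> do over.
  over.
under eq_bigr => r /negPf -> do over.
rewrite cE intc //; apply.
- by apply/eqP; move: cardJ; rewrite (cardsD1 r0) r0J add1n => -[->].
- by move=> r x; case: eqP.
- by move=> r; case: eqP => // _; exact: measurable_indic.
- move=> r; case: eqP => // _; under eq_integral => w _ do
    rewrite -[\1__ _]/(\1_(X r @^-1` A) w).
  have mXA : measurable (X r @^-1` A) by rewrite -[_ @^-1` _]setTI; exact: mX.
  by rewrite integral_indic // classical_sets.setIT (le_lt_trans (probability_le1 P mXA)) // ltry.
- move=> r; rewrite !inE negb_and negbK; case: eqP => [_ _|_ /=]; first by exists A.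
  exact: phiJ.
Qed.

Lemma integral_prod_independent (phi : 'I_s -> R -> R) :
  (forall r x, 0 <= phi r x) -> (forall r, measurable_fun setT (phi r)) ->
  (forall r, \int[P]_w (phi r (X r w))%:E < +oo)%E ->
  (\int[P]_w (\prod_(r < s) phi r (X r w))%:E =
   \prod_(r < s) \int[P]_w (phi r (X r w))%:E)%E.
Proof.
move=> phi0 mphi phifin; apply: (@independent_product_rule _ [set: _]%SET) => //.
by move=> r; rewrite inE.
Qed.

End ProductRule.

End IndependentProducts.

(** * Simultaneous diagonalization of Hermitian matrices *)

Section SimultaneousDiagonalization.
Local Open Scope sesquilinear_scope.
Context {C : numClosedFieldType} {N : nat}.
Implicit Types (A B : 'M[C]_N).

Lemma adjmx_mul m n k (A : 'M[C]_(m, n)) (B : 'M[C]_(n, k)) :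
  (A *m B)^t* = B^t* *m A^t*.
Proof. by rewrite trmx_mul map_mxM. Qed.

Lemma adjmxK m n (A : 'M[C]_(m, n)) : A^t*^t* = A.
Proof. exact: trmxCK. Qed.

Lemma hermsymmxP A : reflect (A^t* = A) (A \is hermsymmx).
Proof.
by rewrite is_hermitianmxE expr0 scale1r eq_sym; exact: eqP.
Qed.

Lemma diag_form (l : 'rV[C]_N) (z : 'cV[C]_N) :
  (z^t* *m diag_mx l *m z) 0 0 = \sum_i l 0 i * `|z i 0| ^+ 2.
Proof.
rewrite mxE; apply: eq_bigr => i _.
rewrite mul_mx_diag !mxE normCK; ring.
Qed.

Lemma posdef_diag (l : 'rV[C]_N) : (forall i, 0 < l 0 i) -> posdefmx (diag_mx l).
Proof.
move=> l0 z; case/cV0Pn => i zi; rewrite diag_form.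
rewrite (bigD1 i) //= ltr_pwDl ?mulr_gt0 ?exprn_gt0 ?normr_gt0 //.
by rewrite sumr_ge0 // => j _; rewrite mulr_ge0 ?exprn_ge0 ?(ltW (l0 j)).
Qed.

Lemma posdef_congr A B : B \in unitmx -> posdefmx A -> posdefmx (B *m A *m B^t*).
Proof.
move=> uB pA z z0; rewrite !mulmxA -(mulmxA _ (B^t*)).
have -> : z^t* *m B = (B^t* *m z)^t* by rewrite adjmx_mul adjmxK.
apply: pA; apply: contra z0 => /eqP H.
have uB' : B^t* \in unitmx by rewrite map_unitmx unitmx_tr.
by rewrite -(mulKmx uB' z) H mulmx0.
Qed.

(** The eigenvalues are positive, being the values of the form at the
    eigenvectors; their square roots provide the factor. *)
Lemma posdef_factor A : A \is hermsymmx -> posdefmx A ->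
  exists2 B : 'M[C]_N, B \in unitmx & A = B^t* *m B.
Proof.
move=> hA pA; have /orthomx_spectralP := hermitian_normalmx hA.
set U := spectralmx A; set l := spectral_diag A => AE.
have uU : U \is unitarymx := spectral_unitarymx A.
have unU : U \in unitmx := spectral_unit A.
rewrite (invmx_unitary uU) in AE.
have l0 i : 0 < l 0 i.
  pose e : 'cV[C]_N := delta_mx i 0; pose z : 'cV[C]_N := U^t* *m e.
  have Uz : U *m z = e by rewrite mulmxA (unitarymxP uU) mul1mx.
  have z0 : z != 0.
    apply/eqP => z0; move: Uz; rewrite z0 mulmx0 => /matrixP/(_ i 0).
    by rewrite !mxE !eqxx => /eqP; rewrite eq_sym oner_eq0.
  (* [z] is the [i]-th eigenvector, and has norm one. *)
  have -> : l 0 i = (z^t* *m A *m z) 0 0.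
    clearbody z; rewrite AE !mulmxA -(mulmxA _ U) Uz -adjmx_mul Uz diag_form (bigD1 i) //=.
    rewrite big1 => [|j ji].
      by rewrite !mxE !eqxx normr1 expr1n mulr1 addr0.
    by rewrite !mxE (negPf ji) normr0 expr0n mulr0.
  exact: pA.
pose r : 'rV[C]_N := \row_i sqrtC (l 0 i).
have r0 i : 0 < r 0 i by rewrite mxE sqrtC_gt0.
exists (diag_mx r *m U).
  rewrite unitmx_mul unU andbT unitmxE det_diag unitfE.
  by apply/prodf_neq0 => i _; rewrite gt_eqF.
have rr : diag_mx r ^t* = diag_mx r.
  rewrite tr_diag_mx map_diag_mx; congr diag_mx; apply/rowP => i.
  by rewrite mxE; apply/CrealP/ger0_real/ltW.
rewrite adjmx_mul rr !mulmxA -(mulmxA (U^t*)) mulmx_diag AE.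
congr (_ *m diag_mx _ *m _); apply/rowP => i.
by rewrite !mxE -expr2 sqrtCK.
Qed.

(** With [S] written as [B^t* *m B], the matrix [B *m A *m B^t*] is Hermitian. If the
    unitary matrix [U] diagonalizes it, then [Q] is [U *m B]. *)
Lemma simultaneous_diagonalization (S A : 'M[C]_N) :
  S \is hermsymmx -> posdefmx S -> A \is hermsymmx ->
  exists (Q : 'M[C]_N) (l : 'rV[C]_N),
    [/\ Q \in unitmx, forall i, l 0 i \is Num.real, S = Q^t* *m Q &
        A = invmx Q *m diag_mx l *m (invmx Q)^t*].
Proof.
move=> hS pS hA; have [B uB SE] := posdef_factor hS pS.
pose H := B *m A *m B^t*.
have hH : H \is hermsymmx.
  by apply/hermsymmxP; rewrite /H !adjmx_mul adjmxK (hermsymmxP _ hA) mulmxA.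
have /orthomx_spectralP := hermitian_normalmx hH.
set U := spectralmx H; set l := spectral_diag H => HE.
have uU : U \is unitarymx := spectral_unitarymx H.
have unU : U \in unitmx := spectral_unit H.
have uB' : B^t* \in unitmx by rewrite map_unitmx unitmx_tr.
exists (U *m B), l; split.
- by rewrite unitmx_mul unU.
- by move=> i; have /mxOverP := hermitian_spectral_diag_real hH; apply.
- rewrite adjmx_mul mulmxA -(mulmxA _ (U^t*)) -(invmx_unitary uU) mulVmx //.
  by rewrite mulmx1.
- have inv : invmx (U *m B) = invmx B *m invmx U.
    apply: (can_inj (mulKmx (_ : U *m B \in unitmx))).
      by rewrite unitmx_mul unU.
    rewrite mulmxV ?unitmx_mul ?unU // mulmxA -(mulmxA U) mulmxV // mulmx1.
    by rewrite mulmxV.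
  rewrite inv adjmx_mul (invmx_unitary uU) adjmxK.
  rewrite -(invmx_unitary uU) !mulmxA -(mulmxA (invmx B)) -(mulmxA (invmx B)).
  rewrite -HE /H !mulmxA mulVmx // mul1mx -mulmxA.
  by rewrite -adjmx_mul mulVmx // trmx1 map_mx1 mulmx1.
Qed.

End SimultaneousDiagonalization.

(** * Traces of Wishart matrices *)

Section WishartTraces.
Local Open Scope sesquilinear_scope.
Local Open Scope classical_set_scope.
Local Open Scope ring_scope.
Context {R : realType} {N : nat}.

Lemma ReD (x y : R[i]) : complex.Re (x + y) = complex.Re x + complex.Re y.
Proof. by case: x; case: y. Qed.

Lemma ImD (x y : R[i]) : complex.Im (x + y) = complex.Im x + complex.Im y.
Proof. by case: x; case: y. Qed.

Lemma ReM (x y : R[i]) : complex.Re (x * y) =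
  complex.Re x * complex.Re y - complex.Im x * complex.Im y.
Proof. by case: x; case: y. Qed.

Lemma ImM (x y : R[i]) : complex.Im (x * y) =
  complex.Re x * complex.Im y + complex.Im x * complex.Re y.
Proof. by case: x; case: y. Qed.

Lemma Re_sum (J : Type) (s : seq J) (f : J -> R[i]) :
  complex.Re (\sum_(j <- s) f j) = \sum_(j <- s) complex.Re (f j).
Proof. by apply: (big_morph (@complex.Re R)) => //; exact: ReD. Qed.

Lemma Re_scale (x : R) (z : R[i]) : complex.Re (x%:C * z) = x * complex.Re z.
Proof. by rewrite ReM /= mul0r subr0. Qed.

Lemma measurable_Re_trace (d : measure_display) (T : measurableType d)
    (W : T -> 'M[R[i]]_N) (theta : 'M[R[i]]_N) :
  (forall i j, measurable_fun setT (fun w => complex.Re (W w i j)) /\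
               measurable_fun setT (fun w => complex.Im (W w i j))) ->
  measurable_fun setT (fun w => complex.Re (\tr (theta *m W w))).
Proof.
move=> mW; rewrite (_ : (fun w => _) = (fun w => \sum_(i < N) \sum_(j < N)
    (complex.Re (theta i j) * complex.Re (W w j i) -
     complex.Im (theta i j) * complex.Im (W w j i)))); last first.
  apply/funext => w; rewrite /mxtrace Re_sum; apply: eq_bigr => i _.
  by rewrite mxE Re_sum; apply: eq_bigr => j _; exact: ReM.
apply: measurable_sum => i; apply: measurable_sum => j.
have [mRe mIm] := mW j i.
by apply: measurable_funB; apply: measurable_funM.
Qed.

Context {d : measure_display} {T : measurableType d}.
Variable P : probability T R.

(** [measurable_Re_trace] holds for any measurable structure that makes the entries
    measurable, in particular for the one that they generate. *)
Lemma sigma_mx_Re_trace (W : T -> 'M[R[i]]_N) (theta : 'M[R[i]]_N) (B : set R) :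
  measurable B ->
  sigma_mx W ((fun w => complex.Re (\tr (theta *m W w))) @^-1` B).
Proof.
move=> mB; rewrite /sigma_mx; set G := (X in <<s X >>).
(* The same set of outcomes, seen with the smaller sigma-algebra. *)
pose T' : measurableType _ := g_sigma_algebraType G.
have mW : forall i j,
    measurable_fun setT (fun w : T' => complex.Re (W w i j)) /\
    measurable_fun setT (fun w : T' => complex.Im (W w i j)).
  move=> i j; split=> _ A mA; apply: sub_gen_smallest; exists (i, j) => //=.
    by left; exists A.
  by right; exists A.
have := @measurable_Re_trace _ T' W theta mW measurableT B mB.
by rewrite classical_sets.setTI.
Qed.

Lemma powR_prod (J : Type) (s : seq J) (a : J -> R) (r : R) :
  (forall j, 0 <= a j) -> (\prod_(j <- s) a j) `^ r = \prod_(j <- s) a j `^ r.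
Proof.
move=> a0; elim: s => [|j s IH]; first by rewrite !big_nil powR1.
by rewrite !big_cons powRM ?IH // prodr_ge0.
Qed.

(** In the coordinates given by [Q], the matrix [invmx Sigma - x theta] becomes
    diagonal with entries [1 - x * lam i]. These control both its positivity and
    the determinant in the Laplace transform. *)
Lemma wishart_laplace_eigen (Sigma theta : 'M[R[i]]_N) (p : R)
    (W : T -> 'M[R[i]]_N) :
  complex_wishart P Sigma p W -> theta \is hermsymmx ->
  exists (Q : 'M[R[i]]_N) (lam : 'I_N -> R),
    [/\ Q \in unitmx,
        theta *m Sigma = invmx Q *m (diag_mx (\row_i (lam i)%:C) *m Q) &
        forall x : R, (forall i, 0 < 1 - x * lam i) ->
          (\int[P]_w (expR (x * complex.Re (\tr (theta *m W w))))%:E)%E =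
          (\prod_(i < N) (1 - x * lam i) `^ (- p))%:E].
Proof.
case=> -[hS pS] _ _ lapl htheta.
have [Q [l [uQ lreal SE tE]]] := simultaneous_diagonalization hS pS htheta.
pose lam i := complex.Re (l 0 i).
have li i : (lam i)%:C = l 0 i by exact: RRe_real.
have lE : l = \row_i (lam i)%:C by apply/rowP => i; rewrite mxE li.
have QQ : (invmx Q)^t* *m Q^t* = 1%:M.
  by rewrite -adjmx_mul mulmxV // trmx1 map_mx1.
have tS : theta *m Sigma = invmx Q *m (diag_mx l *m Q).
  by rewrite tE SE !mulmxA -(mulmxA _ ((invmx Q)^t*)) QQ mulmx1.
exists Q, lam; split; [exact: uQ|by rewrite -lE|move=> x xlam].
pose D := diag_mx (\row_i (1 - x * lam i)%:C).
have DE : 1%:M - x%:C *: diag_mx l = D.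
  apply/matrixP => i j; rewrite !mxE; case: eqP => _; last first.
    by rewrite !mulr0n mulr0 subr0.
  rewrite !mulr1n -li -(rmorphM (real_complex R)) -[1](rmorph1 (real_complex R)).
  by rewrite -(rmorphB (real_complex R)).
have D0 i : 0 < (\row_i (1 - x * lam i)%:C : 'rV[R[i]]_N) 0 i.
  by rewrite mxE ltcR.
have iS : invmx Sigma = invmx Q *m (invmx Q)^t*.
  have uS : Sigma \in unitmx.
    by rewrite SE unitmx_mul uQ map_unitmx unitmx_tr uQ.
  apply: (can_inj (mulKmx uS)); rewrite mulmxV // SE !mulmxA.
  by rewrite -(mulmxA _ Q) mulmxV // mulmx1 -adjmx_mul mulVmx // trmx1 map_mx1.
have herm : x%:C *: theta \is hermsymmx.
  apply/hermsymmxP; rewrite linearZ /= map_mxZ (hermsymmxP _ htheta).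
  by congr (_ *: _); apply: conjc_real.
have pos : posdefmx (invmx Sigma - x%:C *: theta).
  have -> : invmx Sigma - x%:C *: theta = invmx Q *m D *m (invmx Q)^t*.
    by rewrite iS tE -DE mulmxBr mulmx1 mulmxBl -scalemxAr -scalemxAl.
  apply: posdef_congr; first by rewrite unitmx_inv.
  exact: posdef_diag.
have := lapl _ herm pos.
have -> : \det (1%:M - (x%:C *: theta) *m Sigma) = (\prod_(i < N) (1 - x * lam i))%:C.
  have -> : 1%:M - (x%:C *: theta) *m Sigma = invmx Q *m D *m Q.
    rewrite -DE mulmxBr mulmx1 mulmxBl mulVmx // -scalemxAl tS.
    by rewrite -scalemxAr -scalemxAl mulmxA.
  rewrite !det_mulmx mulrAC -det_mulmx mulVmx // det1 mul1r det_diag.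
  by rewrite rmorph_prod; apply: eq_bigr => i _; rewrite mxE.
rewrite /= powR_prod => [<-|i]; last exact: ltW.
rewrite unlock; apply: eq_integral => w _; congr (expR _)%:E.
by rewrite -scalemxAl mxtraceZ Re_scale.
Qed.

End WishartTraces.

Section JointMoments.
Local Open Scope classical_set_scope.
Local Open Scope ring_scope.
Context {d : measure_display} {T : measurableType d} {R : realType}.
Variables (P : probability T R) (s N : nat).
Variables (Sigma : 'I_s -> 'M[R[i]]_N) (p : 'I_s -> R) (W : 'I_s -> T -> 'M[R[i]]_N).
Hypothesis W_wishart : forall r : 'I_s, complex_wishart P (Sigma r) (p r) (W r).
Hypothesis W_indep : independent_mx P W.

(** By independence the Laplace transform of [X] is the product of those of its
    terms, hence a product of powers indexed by the pairs of a color and an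
    eigenvalue index. *)
Lemma joint_wishart_moments (theta : 'I_s -> 'M[R[i]]_N) :
  (forall r, theta r \is hermsymmx) ->
  exists (Q : 'I_s -> 'M[R[i]]_N) (lam : 'I_s * 'I_N -> R),
    [/\ forall r, Q r \in unitmx,
        forall r, theta r *m Sigma r =
          invmx (Q r) *m (diag_mx (\row_i (lam (r, i))%:C) *m Q r) &
        forall k,
        let X w := \sum_(r < s) complex.Re (\tr (theta r *m W r w)) in
        P.-integrable setT (EFin \o (fun w => X w ^+ k)) /\
        (\int[P]_w (X w ^+ k))%R =
          \sum_(a : {ffun 'I_k -> 'I_s * 'I_N})
            color_sum (fun u => p u.1) a * \prod_(j < k) lam (a j)].
Proof.
move=> htheta.
have /choice[Q /choice[lam0 Qlam]] := fun r => wishart_laplace_eigen (W_wishart r) (htheta r).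
pose lam u := lam0 u.1 u.2.
exists Q, lam; split=> [r|r|k X].
- by have [] := Qlam r.
- by have [] := Qlam r.
pose Xr r w := complex.Re (\tr (theta r *m W r w)).
have mXr r : measurable_fun setT (Xr r).
  by have [_ _ [_ mW] _] := W_wishart r; exact: measurable_Re_trace.
have indep B : (forall r, measurable (B r)) ->
    P (\bigcap_(r in setT) Xr r @^-1` B r) = (\prod_(r < s) P (Xr r @^-1` B r))%E.
  move=> mB; have := W_indep (J := [set: 'I_s]%SET) (A := fun r => Xr r @^-1` B r).
  have -> : [set` [set: 'I_s]%SET] = [set: 'I_s] by apply/seteqP; split=> r //=; rewrite inE.
  move=> -> => [|r _]; last exact: sigma_mx_Re_trace.
  by apply: eq_bigl => r; rewrite inE.
apply: prod_powers_moments; first exact: measurable_sum.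
move=> x xlam.
have lapl r : (\int[P]_w (expR (x * Xr r w))%:E)%E =
    (\prod_(i < N) (1 - x * lam0 r i) `^ (- p r))%:E.
  by have [_ _ H] := Qlam r; apply: H => i; exact: (xlam (r, i)).
transitivity (\int[P]_w (\prod_(r < s) expR (x * Xr r w))%:E)%E.
  by apply: eq_integral => w _; rewrite /X big_distrr /= expR_sum.
rewrite (@integral_prod_independent _ _ _ P s Xr mXr indep (fun _ y => expR (x * y))).
- under eq_bigr => r _ do rewrite lapl.
  rewrite prodEFin; congr EFin; rewrite /prod_powers.
  by rewrite (pair_bigA _ (fun r i => (1 - x * lam0 r i) `^ (- p r))).
- by move=> r y; exact: expR_ge0.
- by move=> r; apply: measurableT_comp => //; exact: measurable_funM.
- by move=> r; rewrite lapl ltry.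
Qed.

End JointMoments.

(** * Complex moments of Wishart matrices *)

Section ComplexExpectation.
Local Open Scope classical_set_scope.
Local Open Scope ring_scope.
Context {d : measure_display} {T : measurableType d} {R : realType}.
Variable P : probability T R.

Definition has_cexpectation (X : T -> R[i]) (m : R[i]) : Prop :=
  cintegrable P X /\ cexpectation P X = m.

Lemma cexpectationE (X : T -> R[i]) :
  cexpectation P X = (\int[P]_w complex.Re (X w))%R +i* (\int[P]_w complex.Im (X w))%R.
Proof. by rewrite /cexpectation unlock. Qed.

Lemma has_cexpectation_real (X : T -> R) :
  P.-integrable setT (EFin \o X) ->
  has_cexpectation (fun w => (X w)%:C) ((\int[P]_w X w)%R)%:C.
Proof.
move=> iX; split; first by split => //=; exact: integrable0.
by rewrite cexpectationE /= Rintegral_cst // mul0r.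
Qed.

Lemma has_cexpectationD (X Y : T -> R[i]) (m m' : R[i]) :
  has_cexpectation X m -> has_cexpectation Y m' ->
  has_cexpectation (fun w => X w + Y w) (m + m').
Proof.
move=> [[rX iX] <-] [[rY iY] <-]; split.
  split; under eq_fun do rewrite ?ReD ?ImD EFinD; exact: integrableD.
rewrite !cexpectationE.
under eq_Rintegral do rewrite ReD.
under [X in _ +i* X = _]eq_Rintegral do rewrite ImD.
by rewrite !RintegralD.
Qed.

Lemma has_cexpectationZ (c : R[i]) (X : T -> R[i]) (m : R[i]) :
  has_cexpectation X m -> has_cexpectation (fun w => c * X w) (c * m).
Proof.
move=> [[rX iX] <-].
have iZ (a : R) (f : T -> R) : P.-integrable setT (fun w => (f w)%:E) ->
    P.-integrable setT (fun w => (a * f w)%:E).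
  by move=> i_f; under eq_fun do rewrite EFinM; exact: integrableZl.
have iB (f g : T -> R) : P.-integrable setT (fun w => (f w)%:E) ->
    P.-integrable setT (fun w => (g w)%:E) ->
    P.-integrable setT (fun w => (f w - g w)%:E).
  by move=> i_f i_g; under eq_fun do rewrite EFinB; exact: integrableB.
have iD (f g : T -> R) : P.-integrable setT (fun w => (f w)%:E) ->
    P.-integrable setT (fun w => (g w)%:E) ->
    P.-integrable setT (fun w => (f w + g w)%:E).
  by move=> i_f i_g; under eq_fun do rewrite EFinD; exact: integrableD.
split.
  by split; under eq_fun do rewrite ?ReM ?ImM; [apply: iB|apply: iD]; exact: iZ.
rewrite !cexpectationE.
under eq_Rintegral do rewrite ReM.
under [X in _ +i* X = _]eq_Rintegral do rewrite ImM.
rewrite RintegralB ?RintegralD ?RintegralZl //; try exact: iZ.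
by case: c.
Qed.

Lemma has_cexpectation_sum (J : Type) (r : seq J) (Q : pred J)
    (X : J -> T -> R[i]) (m : J -> R[i]) :
  (forall j, has_cexpectation (X j) (m j)) ->
  has_cexpectation (fun w => \sum_(j <- r | Q j) X j w) (\sum_(j <- r | Q j) m j).
Proof.
move=> Xm; elim: r => [|j r IH].
  rewrite big_nil; under eq_fun do rewrite big_nil.
  have := @has_cexpectation_real (fun=> 0).
  by rewrite Rintegral_cst // mul0r; apply; exact: integrable0.
rewrite big_cons; under eq_fun do rewrite big_cons.
by case: ifP => // _; exact: has_cexpectationD.
Qed.

End ComplexExpectation.

Section HermitianTraces.
Local Open Scope sesquilinear_scope.
Context {R : realType} {N : nat}.
Implicit Types A B : 'M[R[i]]_N.

Lemma conjC_trace A : (\tr A)^* = \tr (A^t*).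
Proof.
rewrite /mxtrace rmorph_sum; apply: eq_bigr => i _.
by rewrite !mxE.
Qed.

Lemma Re_trace_hermitian A B : A \is hermsymmx -> B \is hermsymmx ->
  (complex.Re (\tr (A *m B)))%:C = \tr (A *m B).
Proof.
move=> /hermsymmxP hA /hermsymmxP hB; apply: RRe_real; apply/CrealP.
by rewrite -[LHS]/((\tr (A *m B))^*) conjC_trace adjmx_mul hA hB mxtrace_mulC.
Qed.

Lemma hermsymmx_sum (J : Type) (r : seq J) (Q : pred J) (A : J -> 'M[R[i]]_N) :
  (forall j, A j \is hermsymmx) -> \sum_(j <- r | Q j) A j \is hermsymmx.
Proof.
move=> hA; apply/hermsymmxP; rewrite linear_sum /= map_mx_sum.
by apply: eq_bigr => j _; exact/hermsymmxP.
Qed.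

End HermitianTraces.

Section HermitianParts.
Local Open Scope sesquilinear_scope.

(** Hermitian real and imaginary parts. *)
Lemma hermitian_decomposition (C : numClosedFieldType) (N : nat) (A : 'M[C]_N) :
  exists H : bool -> 'M[C]_N, (forall e, H e \is hermsymmx) /\
    A = \sum_e (if e then 1 else 'i) *: H e.
Proof.
pose B := A^t*.
pose H e := if e then 2^-1 *: (A + B) else (2^-1 * - 'i) *: (A - B).
have conj2 : ((2^-1 : C)^*) = 2^-1 by rewrite fmorphV rmorph_nat.
exists H; split=> [[]|].
- apply/hermsymmxP/matrixP => i j; rewrite !mxE rmorphM /= conj2 rmorphD /= conjCK.
  by rewrite addrC.
- apply/hermsymmxP/matrixP => i j; rewrite !mxE !rmorphM /= conj2 rmorphB rmorphN /=.
  by rewrite conjCi conjCK opprK; ring.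
rewrite big_bool /H /= scale1r scalerA mulrCA mulrN -expr2 sqrCi opprK mulr1.
rewrite -scalerDr addrACA subrr addr0 -mulr2n -scaler_nat scalerA.
by rewrite mulVf ?scale1r // pnatr_eq0.
Qed.

End HermitianParts.

Section WishartMoments.
Local Open Scope classical_set_scope.
Local Open Scope ring_scope.
Context {d : measure_display} {T : measurableType d} {R : realType}.
Variables (P : probability T R) (s N : nat).
Variables (Sigma : 'I_s -> 'M[R[i]]_N) (p : 'I_s -> R) (W : 'I_s -> T -> 'M[R[i]]_N).
Hypothesis W_wishart : forall r : 'I_s, complex_wishart P (Sigma r) (p r) (W r).
Hypothesis W_indep : independent_mx P W.
Let pc r := (p r)%:C.

Lemma W_hermitian r w : W r w \is hermsymmx.
Proof. by have [_ _ [hW _] _] := W_wishart r; exact: hW. Qed.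

Lemma rmorph_color_sum (I : finType) (pI : I -> R) (k : nat) (a : 'I_k -> I) :
  (color_sum pI a)%:C = color_sum (fun u => (pI u)%:C) a.
Proof.
rewrite /color_sum rmorph_sum; apply: eq_bigr => alpha _.
rewrite /orbit_prod rmorph_prod; apply: eq_bigr => c _.
by rewrite /orbit_value; case: pickP => // _; exact: rmorph1.
Qed.

(** The moments of [joint_wishart_moments], with the eigenvalues repackaged as
    traces. *)
Lemma power_trace_moments (k : nat) (theta : 'I_s -> 'M[R[i]]_N) :
  (forall r, theta r \is hermsymmx) ->
  has_cexpectation P (fun w => (\sum_(r < s) \tr (theta r *m W r w)) ^+ k)
    (\sum_(t : {ffun 'I_k -> 'I_s})
       colored_trace_sum pc t (fun j => theta (t j) *m Sigma (t j))).
Proof.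
move=> htheta.
have [Q [lam [uQ tS mom]]] := joint_wishart_moments W_wishart W_indep htheta.
have [iX eX] := mom k; have := has_cexpectation_real iX; rewrite {}eX.
congr has_cexpectation.
  apply/funext => w; rewrite rmorphXn rmorph_sum; congr (_ ^+ _).
  by apply: eq_bigr => r _; apply: Re_trace_hermitian => //; exact: W_hermitian.
under [RHS]eq_bigr => t _.
  rewrite (@eq_colored_trace_sum _ _ _ _ _ _ _ (fun j => invmx (Q (t j)) *m
    (diag_mx (\row_i (lam (t j, i))%:C) *m Q (t j)))); last by move=> j; rewrite tS.
  over.
rewrite (@sum_colored_trace_diag _ _ _ pc k (fun r => invmx (Q r))
  (fun r => diag_mx (\row_i (lam (r, i))%:C) *m Q r)
  (fun r => \row_i (lam (r, i))%:C)); last first.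
  by move=> r; rewrite mulmxK.
rewrite rmorph_sum; apply: eq_bigr => a _.
rewrite rmorphM rmorph_prod; congr (_ * _); first exact: rmorph_color_sum.
by apply: eq_bigr => j _; rewrite mxE -surjective_pairing.
Qed.

(** The product over [j] is a combination of powers of sums, by Ryser's formula
    for a matrix with equal rows, and the expectations of these powers combine by
    polarization. *)
Lemma hermitian_mixed_moments (n : nat) (t : 'I_n -> 'I_s) (theta : 'I_n -> 'M[R[i]]_N) :
  (forall j, theta j \is hermsymmx) ->
  has_cexpectation P (fun w => \prod_j \tr (theta j *m W (t j) w))
    (colored_trace_sum pc t (fun j => theta j *m Sigma (t j))).
Proof.
move=> htheta.
have nfact : (n`!%:R : R[i]) != 0 by rewrite pnatr_eq0 -lt0n fact_gt0.
pose Z i r := theta i *m Sigma r.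
have mean : n`!%:R^-1 * \sum_(S : {set 'I_n}) (-1) ^+ #|~: S|%SET *
     \sum_(t' : {ffun 'I_n -> 'I_s})
        colored_trace_sum pc t' (fun j => \sum_(i in S | t i == t' j) Z i (t' j)) =
  colored_trace_sum pc t (fun j => theta j *m Sigma (t j)).
  by rewrite colored_trace_sum_polarization mulKf.
have prodE w : n`!%:R^-1 * \sum_(S : {set 'I_n}) (-1) ^+ #|~: S|%SET *
     (\sum_(r < s) \tr ((\sum_(i in S | t i == r) theta i) *m W r w)) ^+ n =
  \prod_j \tr (theta j *m W (t j) w).
  transitivity (n`!%:R^-1 * \sum_(S : {set 'I_n}) (-1) ^+ #|~: S|%SET *
     \prod_(j < n) \sum_(i in S) \tr (theta i *m W (t i) w)).
    congr (_ * _); apply: eq_bigr => S _; rewrite prodr_const card_ord.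
    congr (_ * _ ^+ _); rewrite [RHS](partition_big t predT) //=.
    apply: eq_bigr => r _; rewrite mulmx_suml raddf_sum /=.
    by apply: eq_bigr => i /andP[_ /eqP <-].
  rewrite (ryser (fun _ i => \tr (theta i *m W (t i) w))).
  transitivity (n`!%:R^-1 * \sum_(pi : {perm 'I_n}) \prod_j \tr (theta j *m W (t j) w)).
    congr (_ * _); apply: eq_bigr => pi _.
    by rewrite [RHS](reindex_inj (@perm_inj _ pi)).
  by rewrite sumr_const card_Sn -[X in _ * X]mulr_natl mulKf.
rewrite -mean -(funext prodE).
apply: has_cexpectationZ; apply: has_cexpectation_sum => S.
apply: has_cexpectationZ.
under eq_bigr => t' _.
  rewrite (@eq_colored_trace_sum _ _ _ _ _ _ _
    (fun j => (\sum_(i in S | t i == t' j) theta i) *m Sigma (t' j))); last first.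
    by move=> j; rewrite mulmx_suml.
  over.
apply: (@power_trace_moments n (fun r => \sum_(i in S | t i == r) theta i)) => r.
exact: hermsymmx_sum.
Qed.

(** Both sides are complex multilinear in [theta], and Hermitian matrices span all
    matrices. *)
Lemma mixed_moments (n : nat) (t : 'I_n -> 'I_s) (theta : 'I_n -> 'M[R[i]]_N) :
  has_cexpectation P (fun w => \prod_j \tr (theta j *m W (t j) w))
    (colored_trace_sum pc t (fun j => theta j *m Sigma (t j))).
Proof.
have /choice[H Htheta] := fun j => hermitian_decomposition (theta j).
pose c (e : bool) : R[i] := if e then 1 else 'i.
have -> : colored_trace_sum pc t (fun j => theta j *m Sigma (t j)) =
    \sum_(eps : {ffun 'I_n -> bool}) (\prod_j c (eps j)) *
      colored_trace_sum pc t (fun j => H j (eps j) *m Sigma (t j)).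
  rewrite -(colored_trace_sum_multilinear _ _ (fun _ e => c e)
    (fun j e => H j e *m Sigma (t j))).
  apply: eq_colored_trace_sum => j; rewrite {1}(Htheta j).2 mulmx_suml.
  by apply: eq_bigr => e _; rewrite scalemxAl.
have prodE w : \sum_(eps : {ffun 'I_n -> bool}) (\prod_j c (eps j)) *
    \prod_j \tr (H j (eps j) *m W (t j) w) = \prod_j \tr (theta j *m W (t j) w).
  under [LHS]eq_bigr => eps _ do rewrite -big_split /=.
  rewrite -(bigA_distr_bigA (fun j e => c e * \tr (H j e *m W (t j) w))) /=.
  apply: eq_bigr => j _; rewrite [in RHS](Htheta j).2 mulmx_suml raddf_sum /=.
  by apply: eq_bigr => e _; rewrite -scalemxAl mxtraceZ.
rewrite -(funext prodE); apply: has_cexpectation_sum => eps.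
apply: has_cexpectationZ; apply: hermitian_mixed_moments => j.
by have [] := Htheta j.
Qed.

(** Products of entries are products of traces against matrix units, whose moments
    are known; summing them over the index functions composes each permutation
    with [sigma]. *)
Lemma wishart_q_moment (n : nat) (t : 'I_n -> 'I_s) (h : 'I_n -> 'M[R[i]]_N)
    (sigma : {perm 'I_n}) : (0 < N)%N ->
  has_cexpectation P (fun w => q sigma t h (fun r => W r w))
    (\sum_(alpha in color_preserving t)
      (\prod_(r < s) (p r)%:C ^+ #|color_cycles t r alpha|)
      * q (alpha * sigma)%g t h Sigma).
Proof.
move=> N_gt0.
have -> : \sum_(alpha in color_preserving t)
      (\prod_(r < s) (p r)%:C ^+ #|color_cycles t r alpha|)
      * q (alpha * sigma)%g t h Sigma =
    \sum_(b : {ffun 'I_n -> 'I_N}) colored_trace_sum pc t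
      (fun j => (delta_mx (b (sigma j)) (b j) *m h j) *m Sigma (t j)).
  rewrite /colored_trace_sum exchange_big /=.
  apply: eq_big => [alpha|alpha alphat]; first by rewrite inE.
  rewrite -big_distrr /= orbit_prod_colors //; congr (_ * _).
  rewrite q_perm_trace // -perm_trace_compose; apply: eq_bigr => b _.
  by apply: eq_perm_trace => j; rewrite mulmxA.
have qE w : \sum_(b : {ffun 'I_n -> 'I_N}) \prod_j
    \tr ((delta_mx (b (sigma j)) (b j) *m h j) *m W (t j) w) =
    q sigma t h (fun r => W r w).
  rewrite q_perm_trace // perm_trace_expand; apply: eq_bigr => b _.
  by apply: eq_bigr => j _; rewrite mulmxA.
rewrite -(funext qE); apply: has_cexpectation_sum => b.
exact: mixed_moments.
Qed.

End WishartMoments.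

Theorem theorem2p1 (d : measure_display) (T : measurableType d) (R : realType)
    (P : probability T R) (n s N : nat)
    (n_ge1 : (1 <= n)%N) (s_ge1 : (1 <= s)%N) (N_ge1 : (1 <= N)%N)
    (t : 'I_n -> 'I_s) (h : 'I_n -> 'M[R[i]]_N) (sigma : {perm 'I_n})
    (Sigma : 'I_s -> 'M[R[i]]_N) (p : 'I_s -> R)
    (W : 'I_s -> T -> 'M[R[i]]_N)
    (W_wishart : forall r : 'I_s, complex_wishart P (Sigma r) (p r) (W r))
    (W_indep : independent_mx P W) :
  cintegrable P (fun w => q sigma t h (fun r => W r w)) /\
  cexpectation P (fun w => q sigma t h (fun r => W r w)) =
    \sum_(alpha in color_preserving t)
      (\prod_(r < s) ((p r)%:C ^+ #|color_cycles t r alpha|))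
      * q (alpha * sigma)%g t h Sigma.
Proof. exact: (wishart_q_moment W_wishart W_indep t h sigma N_ge1). Qed.
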